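(* There is a polynomial-time $8.928$-approximation algorithm for the MinMD$+$OCTC problem restricted to instances in which every target is far from every base station, namely $\min_{i,k}\|t_i b_k\|>10r$.
   Context: MinMD$+$OCTC: targets $\mathcal{T}=\{t_1,\dots,t_n\}$ and base stations $\mathcal{B}=\{b_1,\dots,b_m\}$ are points of the Euclidean plane; base station $b_k$ has opening cost $c_k\ge 0$; a radius $r>0$ is given. A solution consists of a set of opened base stations and a finite multiset of mobile sensors; each sensor is emitted by an opened base station and moved to an arbitrary destination point in the plane, its moving distance being the Euclidean distance from its base station to its destination. A sensor covers a target if the target is within Euclidean distance $r$ of the sensor's destination; an opened base station may emit arbitrarily many sensors. A solution is feasible if every target is covered; its cost is the sum of opening costs of the opened base stations plus the total moving distance of all sensors. The goal is to minimize the cost. $\|t_i b_k\|$ denotes the Euclidean distance between $t_i$ and $b_k$. An $\alpha$-approximation algorithm returns a feasible solution of cost at most $\alpha$ times the optimum. *)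

(* Defs.v *)
From Stdlib Require Import Reals List Arith.
Import ListNotations.
Open Scope R_scope.

Definition point := (R * R)%type.

Definition dist (p q : point) : R :=
  sqrt ((fst p - fst q) ^ 2 + (snd p - snd q) ^ 2).

(* An instance: n targets t 0 .. t (n-1), m base stations b 0 .. b (m-1)
   with opening costs c 0 .. c (m-1), and a radius r. *)
Record instance := Instance {
  n_tg : nat;
  m_bs : nat;
  tg : nat -> point;
  bs : nat -> point;
  ocost : nat -> R;
  radius : R
}.

Definition valid_instance (I : instance) : Prop :=
  0 < radius I /\ (forall k, (k < m_bs I)%nat -> 0 <= ocost I k).

(* A solution: the set of opened base stations (as a boolean predicate on
   station indices) and a finite multiset (list) of mobile sensors, each given
   by the index of its emitting station and its destination point. *)
Record solution := Solution {
  opened : nat -> bool;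
  sensors : list (nat * point)
}.

Definition feasible (I : instance) (S : solution) : Prop :=
  (forall k, opened S k = true -> (k < m_bs I)%nat) /\
  (forall s, In s (sensors S) -> (fst s < m_bs I)%nat /\ opened S (fst s) = true) /\
  (forall i, (i < n_tg I)%nat ->
     exists s, In s (sensors S) /\ dist (tg I i) (snd s) <= radius I).

Fixpoint sum_upto (f : nat -> R) (k : nat) : R :=
  match k with O => 0 | S k' => sum_upto f k' + f k' end.

Definition sol_cost (I : instance) (S : solution) : R :=
  sum_upto (fun k => if opened S k then ocost I k else 0) (m_bs I)
  + fold_right (fun s acc => dist (bs I (fst s)) (snd s) + acc) 0 (sensors S).

Definition far_instance (I : instance) : Prop :=
  forall i k, (i < n_tg I)%nat -> (k < m_bs I)%nat ->
    dist (tg I i) (bs I k) > 10 * radius I.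

(* Two memories: real registers rm and natural-number registers im.
   Operations: +, -, *, /, sqrt on reals, comparisons, integer constants,
   integer +, truncated -, nat->real conversion, indirect addressing,
   conditional jumps, and output instructions. (No floor function.) *)
Inductive instr :=
| RAdd (d a b : nat) | RSub (d a b : nat) | RMul (d a b : nat)
| RDiv (d a b : nat) | RSqrt (d a : nat)
| RLoad (d i : nat)
| RStore (i s : nat)
| OfNat (d i : nat)
| IConst (d k : nat) | IAdd (d a b : nat) | ISub (d a b : nat)
| ILoad (d i : nat)
| IStore (i s : nat)
| JRle (a b l : nat)
| JIle (a b l : nat)
| OutOpen (i : nat)
| OutSensor (i x y : nat)
| Halt.

Record config := Config {
  pc : nat;
  rm : nat -> R;
  im : nat -> nat;
  out_open : list nat;
  out_sens : list (nat * point)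
}.

Definition updR (f : nat -> R) (a : nat) (v : R) : nat -> R :=
  fun j => if Nat.eqb j a then v else f j.
Definition updN (f : nat -> nat) (a : nat) (v : nat) : nat -> nat :=
  fun j => if Nat.eqb j a then v else f j.

Definition setR (c : config) (a : nat) (v : R) : config :=
  Config (S (pc c)) (updR (rm c) a v) (im c) (out_open c) (out_sens c).
Definition setN (c : config) (a : nat) (v : nat) : config :=
  Config (S (pc c)) (rm c) (updN (im c) a v) (out_open c) (out_sens c).
Definition jump (c : config) (b : bool) (l : nat) : config :=
  Config (if b then l else S (pc c)) (rm c) (im c) (out_open c) (out_sens c).

Definition step (p : list instr) (c : config) : option config :=
  match nth_error p (pc c) with
  | None | Some Halt => None
  | Some ins => Some
    match ins with
    | RAdd d a b => setR c d (rm c a + rm c b)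
    | RSub d a b => setR c d (rm c a - rm c b)
    | RMul d a b => setR c d (rm c a * rm c b)
    | RDiv d a b => setR c d (rm c a / rm c b)
    | RSqrt d a => setR c d (sqrt (rm c a))
    | RLoad d i => setR c d (rm c (im c i))
    | RStore i s => setR c (im c i) (rm c s)
    | OfNat d i => setR c d (INR (im c i))
    | IConst d k => setN c d k
    | IAdd d a b => setN c d (im c a + im c b)
    | ISub d a b => setN c d (im c a - im c b)
    | ILoad d i => setN c d (im c (im c i))
    | IStore i s => setN c (im c i) (im c s)
    | JRle a b l => jump c (if Rle_dec (rm c a) (rm c b) then true else false) l
    | JIle a b l => jump c (Nat.leb (im c a) (im c b)) l
    | OutOpen i =>
        Config (S (pc c)) (rm c) (im c) (im c i :: out_open c) (out_sens c)
    | OutSensor i x y =>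
        Config (S (pc c)) (rm c) (im c) (out_open c)
               ((im c i, (rm c x, rm c y)) :: out_sens c)
    | Halt => c
    end
  end.

Fixpoint run (p : list instr) (T : nat) (c : config) : option config :=
  match step p c with
  | None => Some c
  | Some c' => match T with O => None | S T' => run p T' c' end
  end.

Definition input_rm (I : instance) : nat -> R :=
  fun j =>
    let n := n_tg I in let m := m_bs I in
    if Nat.ltb j (2 * n) then
      (if Nat.even j then fst (tg I (Nat.div2 j)) else snd (tg I (Nat.div2 j)))
    else if Nat.ltb j (2 * n + 2 * m) then
      (let j' := (j - 2 * n)%nat in
       if Nat.even j' then fst (bs I (Nat.div2 j')) else snd (bs I (Nat.div2 j')))
    else if Nat.ltb j (2 * n + 3 * m) then ocost I (j - (2 * n + 2 * m))
    else if Nat.eqb j (2 * n + 3 * m) then radius I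
    else 0.

Definition input_im (I : instance) : nat -> nat :=
  fun j => match j with 0 => n_tg I | 1 => m_bs I | _ => 0%nat end.

Definition init_config (I : instance) : config :=
  Config 0 (input_rm I) (input_im I) [] [].

Definition output_solution (c : config) : solution :=
  Solution (fun k => existsb (Nat.eqb k) (out_open c)) (out_sens c).

Definition poly_time_approx (alpha : R) (P : instance -> Prop) : Prop :=
  exists (p : list instr) (C d : nat),
    forall I, P I ->
      exists c', run p (C * (n_tg I + m_bs I + 1) ^ d) (init_config I) = Some c' /\
        feasible I (output_solution c') /\
        forall S, feasible I S ->
          sol_cost I (output_solution c') <= alpha * sol_cost I S.

(* Main.v *)
From Stdlib Require Import Reals List Arith Lia Lra Psatz Bool.
Require Import Defs.
Import ListNotations.
Open Scope R_scope.

(* Choose targets greedily from left to right, discarding those within 2r of a chosen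
   one. The chosen targets are more than 2r apart, so every feasible solution covers them
   by distinct sensors; since all distances exceed 10r, sending a sensor to a target
   itself costs at most 10/9 as much as sending it to cover the target. Conversely the
   discarded neighbours of a chosen target lie in a half disc of radius 2r, which four
   discs of radius r cover; serving them all costs at most 4.6 times the distance from the
   station to the target.

   It remains to approximate uncapacitated facility location on the chosen targets.
   A local optimum for the moves "close s, open o" satisfies F <= F* + 2C* and
   C <= F* + C*, where F is the opening and C the connection cost, so that
   F + 4.6 C <= 5.6 F* + 6.6 C*. To be polynomial, the search
   accepts only moves that improve the cost by a factor 1 - 1/(64m); it starts from a
   solution of cost at most n times the optimum (every target opens its favourite
   station), so after 64mn sweeps over all moves it has either got stuck, or reached the
   optimal cost. *)

(** Real arithmetic has unit cost, so nothing bounds the size of the opening costs and the number of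
    improving moves cannot be bounded by bit lengths. The start within a factor n of the optimum is
    what bounds it in terms of n and m alone. Removing a factor n takes only about 64m log n
    improvements; allowing 64mn means that no logarithm has to be computed or estimated. There is no
    convergence test either: a stuck sweep changes nothing, so the number of sweeps is fixed in
    advance, every loop bound is n, m or 64m, and the running time can be read off the loop nesting.

    Taking the leftmost target confines its neighbours to a half disc, where three discs around the
    central one suffice; a full disc would need six. The improvement threshold is paid for by
    rounding 5.6 and 6.6 up to 6 and 7, and 7 times 10/9 stays below 8.928. *)

Local Arguments Nat.mul : simpl never.

(** * A small loop language and its compiler *)

Definition NR : nat := 32.

(** The machine keeps real scalars and arrays in one memory [rm]. Separating them here removes all
    address arithmetic and aliasing from the reasoning about programs. *)
Record mem := Mem {
  nr : nat -> nat;
  rr : nat -> R;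
  ar : nat -> nat -> R;
  oo : list nat;
  os : list (nat * point)
}.

Definition wrN (s : mem) d v := Mem (updN (nr s) d v) (rr s) (ar s) (oo s) (os s).
Definition wrR (s : mem) d v := Mem (nr s) (updR (rr s) d v) (ar s) (oo s) (os s).
Definition wrA (s : mem) x j v :=
  Mem (nr s) (rr s)
    (fun y => if Nat.eqb y x then updR (ar s x) j v else ar s y) (oo s) (os s).

Inductive cmd :=
| Skip
| Op (i : instr)
| Ld (d x i : nat)
| St (x i s : nat)
| Seq (c1 c2 : cmd)
| IfR (a b : nat) (c1 c2 : cmd)
| For (i n : nat) (c : cmd).

Fixpoint floop {A} (g : nat -> A -> A) (k : nat) (a : A) : A :=
  match k with O => a | S k' => g k' (floop g k' a) end.

(** A loop reads its bound once and overwrites its counter with [S k], while the compiled code tests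
    the bound in every round and increments the counter. Both agree under [wf], which protects the
    counter from the body and admits only bounds that are never written. *)
Fixpoint den (c : cmd) (s : mem) : mem :=
  match c with
  | Skip => s
  | Op i =>
    match i with
    | RAdd d a b => wrR s d (rr s a + rr s b)
    | RSub d a b => wrR s d (rr s a - rr s b)
    | RMul d a b => wrR s d (rr s a * rr s b)
    | RDiv d a b => wrR s d (rr s a / rr s b)
    | RSqrt d a => wrR s d (sqrt (rr s a))
    | OfNat d j => wrR s d (INR (nr s j))
    | IConst d k => wrN s d k
    | IAdd d a b => wrN s d (nr s a + nr s b)
    | OutOpen j => Mem (nr s) (rr s) (ar s) (nr s j :: oo s) (os s)
    | OutSensor j x y =>
        Mem (nr s) (rr s) (ar s) (oo s) ((nr s j, (rr s x, rr s y)) :: os s)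
    | _ => s
    end
  | Ld d x i => wrR s d (ar s x (nr s i))
  | St x i v => wrA s x (nr s i) (rr s v)
  | Seq c1 c2 => den c2 (den c1 s)
  | IfR a b c1 c2 => if Rle_dec (rr s a) (rr s b) then den c1 s else den c2 s
  | For i n b =>
      floop (fun k s' => wrN (den b s') i (S k)) (nr s n) (wrN s i 0)
  end.

Fixpoint len (c : cmd) : nat :=
  match c with
  | Skip => 0
  | Op _ => 1
  | Ld _ _ _ | St _ _ _ => 7
  | Seq c1 c2 => len c1 + len c2
  | IfR _ _ c1 c2 => 2 + len c1 + len c2
  | For _ _ b => 4 + len b
  end.

(* Machine registers 2, 3, 4 are reserved: scratch address, base address of the
   arrays, and the constant 1. Entry [j] of array [x < 4] lives at base + 4j + x,
   so that the arrays are unbounded and never alias. *)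
Definition addr (x i : nat) : list instr :=
  [IConst 2 x; IAdd 2 2 i; IAdd 2 2 i; IAdd 2 2 i; IAdd 2 2 i; IAdd 2 2 3].

(** Jump targets are absolute, hence the start address [q]. [JRle] jumps when the test holds, so the
    second branch is laid out first. Comparing register 4 with itself gives an unconditional
    jump. *)
Fixpoint comp (q : nat) (c : cmd) : list instr :=
  match c with
  | Skip => []
  | Op i => [i]
  | Ld d x i => addr x i ++ [RLoad d 2]
  | St x i s => addr x i ++ [RStore 2 s]
  | Seq c1 c2 => comp q c1 ++ comp (q + len c1) c2
  | IfR a b c1 c2 =>
      JRle a b (q + 2 + len c2) :: comp (q + 1) c2 ++
      JIle 4 4 (q + 2 + len c2 + len c1) :: comp (q + 2 + len c2) c1
  | For i n b =>
      IConst i 0 :: JIle n i (q + 4 + len b) :: comp (q + 2) b ++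
      [IAdd i i 4; JIle 4 4 (q + 1)]
  end.

(** The written locations are over-approximated by a boolean on the syntax, so that most frame
    conditions below are settled by computation with [eq_refl]. *)
Fixpoint nwr (c : cmd) (r : nat) : bool :=
  match c with
  | Op (IConst d _) | Op (IAdd d _ _) => Nat.eqb r d
  | Seq c1 c2 | IfR _ _ c1 c2 => nwr c1 r || nwr c2 r
  | For i _ b => Nat.eqb r i || nwr b r
  | _ => false
  end.

Fixpoint rwr (c : cmd) (r : nat) : bool :=
  match c with
  | Op (RAdd d _ _) | Op (RSub d _ _) | Op (RMul d _ _) | Op (RDiv d _ _)
  | Op (RSqrt d _) | Op (OfNat d _) | Ld d _ _ => Nat.eqb r d
  | Seq c1 c2 | IfR _ _ c1 c2 => rwr c1 r || rwr c2 r
  | For _ _ b => rwr b r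
  | _ => false
  end.

Fixpoint awr (c : cmd) (x : nat) : bool :=
  match c with
  | St y _ _ => Nat.eqb x y
  | Seq c1 c2 | IfR _ _ c1 c2 => awr c1 x || awr c2 x
  | For _ _ b => awr b x
  | _ => false
  end.

Fixpoint oowr (c : cmd) : bool :=
  match c with
  | Op (OutOpen _) => true
  | Seq c1 c2 | IfR _ _ c1 c2 => oowr c1 || oowr c2
  | For _ _ b => oowr b
  | _ => false
  end.

Fixpoint oswr (c : cmd) : bool :=
  match c with
  | Op (OutSensor _ _ _) => true
  | Seq c1 c2 | IfR _ _ c1 c2 => oswr c1 || oswr c2
  | For _ _ b => oswr b
  | _ => false
  end.

(* Loop bounds must be read-only registers, so that a bound on their initial values
   bounds the running time. *)
Definition param (r : nat) : bool := Nat.eqb r 0 || Nat.eqb r 1 || Nat.eqb r 5.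
Definition okN (r : nat) : bool :=
  negb (Nat.eqb r 2 || Nat.eqb r 3 || Nat.eqb r 4).
Definition okW (r : nat) : bool := okN r && negb (param r).
Definition okR (r : nat) : bool := Nat.ltb r NR.

Fixpoint wf (c : cmd) : bool :=
  match c with
  | Skip => true
  | Op i =>
    match i with
    | RAdd d a b | RSub d a b | RMul d a b | RDiv d a b => okR d && okR a && okR b
    | RSqrt d a => okR d && okR a
    | OfNat d j => okR d && okN j
    | IConst d _ => okW d
    | IAdd d a b => okW d && okN a && okN b
    | OutOpen j => okN j
    | OutSensor j x y => okN j && okR x && okR y
    | _ => false
    end
  | Ld d x i => okR d && Nat.ltb x 4 && okN i
  | St x i s => okR s && Nat.ltb x 4 && okN i
  | Seq c1 c2 => wf c1 && wf c2
  | IfR a b c1 c2 => okR a && okR b && wf c1 && wf c2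
  | For i n b => okW i && param n && negb (nwr b i) && wf b
  end.

(** [X] bounds every loop bound. A round adds its test, the increment and the jump back;
    initialisation and the final test give the other 2. The branches of a conditional are added as a
    crude maximum. *)
Fixpoint tb (c : cmd) (X : nat) : nat :=
  match c with
  | Skip => 0
  | Op _ => 1
  | Ld _ _ _ | St _ _ _ => 7
  | Seq c1 c2 => tb c1 X + tb c2 X
  | IfR _ _ c1 c2 => 2 + tb c1 X + tb c2 X
  | For _ _ b => 2 + X * (tb b X + 3)
  end.

Definition same (c : cmd) (s s' : mem) : Prop :=
  (forall r, nwr c r = false -> nr s' r = nr s r) /\
  (forall r, rwr c r = false -> rr s' r = rr s r) /\
  (forall x, awr c x = false -> ar s' x = ar s x) /\
  (oowr c = false -> oo s' = oo s) /\ (oswr c = false -> os s' = os s).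

Lemma updN_eq f a v : updN f a v a = v.
Proof. unfold updN. now rewrite Nat.eqb_refl. Qed.
Lemma updN_neq f a v r : r <> a -> updN f a v r = f r.
Proof. intros H. unfold updN. destruct (Nat.eqb_spec r a); congruence. Qed.
Lemma updR_eq f a v : updR f a v a = v.
Proof. unfold updR. now rewrite Nat.eqb_refl. Qed.
Lemma updR_neq f a v r : r <> a -> updR f a v r = f r.
Proof. intros H. unfold updR. destruct (Nat.eqb_spec r a); congruence. Qed.

Lemma same_trans c1 c2 c s1 s2 s3 :
  (forall r, nwr c r = false -> nwr c1 r = false /\ nwr c2 r = false) ->
  (forall r, rwr c r = false -> rwr c1 r = false /\ rwr c2 r = false) ->
  (forall x, awr c x = false -> awr c1 x = false /\ awr c2 x = false) ->
  (oowr c = false -> oowr c1 = false /\ oowr c2 = false) ->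
  (oswr c = false -> oswr c1 = false /\ oswr c2 = false) ->
  same c1 s1 s2 -> same c2 s2 s3 -> same c s1 s3.
Proof.
  intros HN HR HA HO HO' (N1 & R1 & A1 & O1 & P1) (N2 & R2 & A2 & O2 & P2).
  repeat split; intros.
  - destruct (HN _ H). rewrite N2, N1; auto.
  - destruct (HR _ H). rewrite R2, R1; auto.
  - destruct (HA _ H). rewrite A2, A1; auto.
  - destruct (HO H). rewrite O2, O1; auto.
  - destruct (HO' H). rewrite P2, P1; auto.
Qed.

Lemma same_refl c s : same c s s.
Proof. repeat split; auto. Qed.

Lemma den_same c : forall s, same c s (den c s).
Proof.
  induction c as [|i|d x i|x i v|c1 IH1 c2 IH2|a b c1 IH1 c2 IH2|i n b IH]; intros s.
  - apply same_refl.
  - destruct i; try apply same_refl; repeat split; simpl; intros; try easy;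
      try (apply Nat.eqb_neq in H);
      try (now rewrite updN_neq); try (now rewrite updR_neq).
  - repeat split; simpl; intros; try easy. apply Nat.eqb_neq in H. now rewrite updR_neq.
  - repeat split; simpl; intros; try easy. now rewrite H.
  - apply (same_trans c1 c2 _ s (den c1 s) _); auto;
      simpl; intros; now apply orb_false_iff.
  - simpl. destruct (Rle_dec _ _).
    + apply (same_trans c1 c1 _ s (den c1 s) _); auto using same_refl;
      simpl; intros; apply orb_false_iff in H; tauto.
    + apply (same_trans c2 c2 _ s (den c2 s) _); auto using same_refl;
      simpl; intros; apply orb_false_iff in H; tauto.
  - simpl. set (g := fun k s' => _). induction (nr s n) as [|k IHk].
    + repeat split; simpl; intros; auto.
      apply orb_false_iff in H as [H _]. apply Nat.eqb_neq in H. now rewrite updN_neq.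
    + simpl floop. set (s' := floop g k (wrN s i 0)) in *.
      apply (same_trans (For i n b) (For i n b) _ s s' _); auto.
      destruct (IH s') as (N1 & R1 & A1 & O1).
      repeat split; simpl; intros; auto; try tauto.
      apply orb_false_iff in H as [H H']. apply Nat.eqb_neq in H.
      rewrite updN_neq; auto.
Qed.

Lemma floop_same i n b s k :
  same (For i n b) s (floop (fun k s' => wrN (den b s') i (S k)) k (wrN s i 0)).
Proof.
  induction k as [|k IHk].
  - repeat split; simpl; intros; auto.
    apply orb_false_iff in H as [H _]. apply Nat.eqb_neq in H. now rewrite updN_neq.
  - simpl floop. set (s' := floop _ k (wrN s i 0)) in *.
    apply (same_trans (For i n b) (For i n b) _ s s' _); auto.
    destruct (den_same b s') as (N1 & R1 & A1 & O1).
    repeat split; simpl; intros; auto; try tauto.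
    apply orb_false_iff in H as [H H']. apply Nat.eqb_neq in H.
    rewrite updN_neq; auto.
Qed.

(** The step premise supplies [same (For i n b) s s'], so an invariant need only mention what the
    loop changes. *)
Lemma for_rule (Inv : nat -> mem -> Prop) i n b s :
  Inv 0%nat (wrN s i 0) ->
  (forall k s', (k < nr s n)%nat -> same (For i n b) s s' -> nr s' i = k ->
     Inv k s' -> Inv (S k) (wrN (den b s') i (S k))) ->
  Inv (nr s n) (den (For i n b) s).
Proof.
  intros H0 HS. simpl. set (g := fun k s' => _).
  assert (forall k, (k <= nr s n)%nat -> Inv k (floop g k (wrN s i 0))) as H.
  { induction k as [|k IHk]; intros Hk; [exact H0|].
    simpl. apply HS; [lia| |destruct k; simpl; apply updN_eq|apply IHk; lia].
    apply floop_same. }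
  apply H. lia.
Qed.

(** * Code placement, exact step counts and correctness of the compiler *)

Definition code_at (p : list instr) (q : nat) (l : list instr) : Prop :=
  forall i ins, nth_error l i = Some ins -> nth_error p (q + i) = Some ins.

Lemma code_at_app p q l1 l2 :
  code_at p q (l1 ++ l2) -> code_at p q l1 /\ code_at p (q + length l1) l2.
Proof.
  intros H. split; intros i ins Hi.
  - apply H. rewrite nth_error_app1; auto. apply nth_error_Some. congruence.
  - rewrite <- Nat.add_assoc. apply H. rewrite nth_error_app2 by lia.
    now replace (length l1 + i - length l1)%nat with i by lia.
Qed.

Lemma code_at_cons p q a l :
  code_at p q (a :: l) -> nth_error p q = Some a /\ code_at p (q + 1) l.
Proof.
  intros H. split.
  - rewrite <- (Nat.add_0_r q). now apply H.
  - intros i ins Hi. replace (q + 1 + i)%nat with (q + S i)%nat by lia. now apply H.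
Qed.

(** Exact step counts compose by addition, unlike the fuel of [run], which also demands that the
    machine stop. *)
Fixpoint nsteps (p : list instr) (t : nat) (c : config) : option config :=
  match t with
  | O => Some c
  | S t' => match step p c with Some c' => nsteps p t' c' | None => None end
  end.

Lemma nsteps_add p t1 t2 c c1 c2 :
  nsteps p t1 c = Some c1 -> nsteps p t2 c1 = Some c2 ->
  nsteps p (t1 + t2) c = Some c2.
Proof.
  revert c. induction t1 as [|t1 IH]; simpl; intros c H1 H2; [congruence|].
  destruct (step p c); [eauto|discriminate].
Qed.

Lemma run_nsteps p t T c c' :
  nsteps p t c = Some c' -> step p c' = None -> (t <= T)%nat -> run p T c = Some c'.
Proof.
  revert T c. induction t as [|t IH]; simpl; intros T c H1 H2 HT.
  - injection H1 as ->. destruct T; simpl; now rewrite H2.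
  - destruct (step p c) as [c1|] eqn:E; [|discriminate].
    destruct T as [|T]; [lia|]. simpl. rewrite E. apply IH; auto; lia.
Qed.

(** Register 2 and the program counter are left unconstrained, so address computations and jumps are
    invisible in [s]. [NR <= B] keeps arrays off the real scalars. *)
Definition sim (B : nat) (s : mem) (c : config) : Prop :=
  (NR <= B)%nat /\ im c 3 = B /\ im c 4 = 1%nat /\
  (forall r, okN r = true -> im c r = nr s r) /\
  (forall r, okR r = true -> rm c r = rr s r) /\
  (forall x j, (x < 4)%nat -> rm c (B + 4 * j + x) = ar s x j) /\
  out_open c = oo s /\ out_sens c = os s.

Lemma sim_pc B s c q :
  sim B s c -> sim B s (Config q (rm c) (im c) (out_open c) (out_sens c)).
Proof. easy. Qed.

Lemma sim_setR B s c d v :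
  okR d = true -> sim B s c -> sim B (wrR s d v) (setR c d v).
Proof.
  intros Hd (HB & H3 & H4 & HN & HR & HA & HO).
  repeat split; simpl; try tauto.
  - intros r Hr. unfold updR. destruct (Nat.eqb r d); auto.
  - intros x j Hx. unfold okR in Hd. rewrite updR_neq; auto.
    apply Nat.ltb_lt in Hd. lia.
Qed.

Lemma sim_setN B s c d v :
  okN d = true -> sim B s c -> sim B (wrN s d v) (setN c d v).
Proof.
  intros Hd (HB & H3 & H4 & HN & HR & HA & HO).
  unfold okN in Hd. rewrite negb_true_iff, !orb_false_iff, !Nat.eqb_neq in Hd.
  repeat split; simpl; try tauto; try (rewrite updN_neq; auto; lia).
  intros r Hr. unfold updN. destruct (Nat.eqb r d); auto.
Qed.

Lemma sim_scratch B s c v : sim B s c -> sim B s (setN c 2 v).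
Proof.
  intros (HB & H3 & H4 & HN & HR & HA & HO).
  repeat split; simpl; try tauto.
  intros r Hr. rewrite updN_neq; auto. intros ->. discriminate.
Qed.

Lemma sim_store B s c x j v a :
  (x < 4)%nat -> a = (B + 4 * j + x)%nat ->
  sim B s c -> sim B (wrA s x j v) (setR c a v).
Proof.
  intros Hx -> (HB & H3 & H4 & HN & HR & HA & HO).
  repeat split; simpl; try tauto.
  - intros r Hr. rewrite updR_neq; auto. unfold okR in Hr.
    apply Nat.ltb_lt in Hr. lia.
  - intros y i Hy. destruct (Nat.eqb_spec y x) as [->|Hyx].
    + destruct (Nat.eq_dec i j) as [->|Hij]; [now rewrite !updR_eq|].
      rewrite !updR_neq by lia. auto.
    + rewrite updR_neq by lia. auto.
Qed.

(** A total variant of [step], which turns the run of straight-line code into a [fold_left]. *)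
Definition ex (c : config) (ins : instr) : config :=
  match ins with
  | RAdd d a b => setR c d (rm c a + rm c b)
  | RSub d a b => setR c d (rm c a - rm c b)
  | RMul d a b => setR c d (rm c a * rm c b)
  | RDiv d a b => setR c d (rm c a / rm c b)
  | RSqrt d a => setR c d (sqrt (rm c a))
  | RLoad d i => setR c d (rm c (im c i))
  | RStore i s => setR c (im c i) (rm c s)
  | OfNat d i => setR c d (INR (im c i))
  | IConst d k => setN c d k
  | IAdd d a b => setN c d (im c a + im c b)
  | ISub d a b => setN c d (im c a - im c b)
  | ILoad d i => setN c d (im c (im c i))
  | IStore i s => setN c (im c i) (im c s)
  | JRle a b l => jump c (if Rle_dec (rm c a) (rm c b) then true else false) l
  | JIle a b l => jump c (Nat.leb (im c a) (im c b)) l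
  | OutOpen i =>
      Config (S (pc c)) (rm c) (im c) (im c i :: out_open c) (out_sens c)
  | OutSensor i x y =>
      Config (S (pc c)) (rm c) (im c) (out_open c)
             ((im c i, (rm c x, rm c y)) :: out_sens c)
  | Halt => c
  end.

Lemma step_ex p c ins :
  nth_error p (pc c) = Some ins -> ins <> Halt -> step p c = Some (ex c ins).
Proof. intros H Hh. unfold step. rewrite H. destruct ins; easy. Qed.

Lemma one_step p c ins :
  nth_error p (pc c) = Some ins -> ins <> Halt -> nsteps p 1 c = Some (ex c ins).
Proof. intros H Hh. simpl. now rewrite (step_ex p c ins). Qed.

Definition straight (ins : instr) : bool :=
  match ins with JRle _ _ _ | JIle _ _ _ | Halt => false | _ => true end.

Lemma straight_steps p l : forall q c,
  code_at p q l -> pc c = q -> forallb straight l = true ->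
  nsteps p (length l) c = Some (fold_left ex l c) /\
  pc (fold_left ex l c) = (q + length l)%nat.
Proof.
  induction l as [|a l IH]; simpl; intros q c H Hq Hs; [split; auto; lia|].
  apply andb_true_iff in Hs as [Ha Hl]. apply code_at_cons in H as [H1 H2].
  rewrite (step_ex p c a); [|congruence|now intros ->].
  destruct (IH (q + 1)%nat (ex c a)) as [E1 E2]; auto.
  - destruct a; try discriminate Ha; simpl; lia.
  - split; [exact E1|]. rewrite E2. lia.
Qed.

Lemma addr_steps p q x i c :
  okN i = true -> code_at p q (addr x i) -> pc c = q ->
  exists c', nsteps p 6 c = Some c' /\ pc c' = (q + 6)%nat /\
    im c' 2 = (im c 3 + 4 * im c i + x)%nat /\
    (forall B s, sim B s c -> sim B s c').
Proof.
  intros Hi H Hpc.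
  destruct (straight_steps p (addr x i) q c H Hpc eq_refl) as [E1 E2].
  eexists. split; [exact E1|]. split; [exact E2|].
  assert (i <> 2%nat) as Hi2 by (intros ->; discriminate).
  split.
  - simpl. rewrite !updN_eq.
    repeat rewrite (updN_neq _ 2 _ i) by auto.
    repeat rewrite (updN_neq _ 2 _ 3) by auto. rewrite ?updN_eq. lia.
  - intros B s HB. simpl. now repeat apply sim_scratch.
Qed.

Lemma wf_param c r : wf c = true -> param r = true -> nwr c r = false.
Proof.
  intros H Hr. induction c as [|i|d x i|x i v|c1 IH1 c2 IH2|a b c1 IH1 c2 IH2|i n b IH];
    simpl in *; auto; repeat rewrite andb_true_iff in H.
  - destruct i; auto; repeat rewrite andb_true_iff in H; unfold okW in H;
    rewrite ?andb_true_iff, negb_true_iff in H; destruct (Nat.eqb_spec r d); auto;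
    subst; intuition congruence.
  - rewrite IH1, IH2; tauto.
  - rewrite IH1, IH2; tauto.
  - rewrite IH by tauto. unfold okW in H. rewrite andb_true_iff, negb_true_iff in H.
    destruct (Nat.eqb_spec r i); auto; subst; intuition congruence.
Qed.

Lemma length_comp c : forall q, length (comp q c) = len c.
Proof.
  induction c; intros q; simpl; auto; rewrite ?length_app; simpl;
    rewrite ?length_app; simpl; rewrite ?IHc, ?IHc1, ?IHc2; lia.
Qed.

Lemma comp_correct c : forall B X p q s cf,
  wf c = true -> code_at p q (comp q c) -> pc cf = q -> sim B s cf ->
  (forall r, param r = true -> (nr s r <= X)%nat) ->
  exists t cf', (t <= tb c X)%nat /\ nsteps p t cf = Some cf' /\
    pc cf' = (q + len c)%nat /\ sim B (den c s) cf'.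
Proof.
  induction c as [|i|d x i|x i v|c1 IH1 c2 IH2|a b c1 IH1 c2 IH2|i n b IH];
    intros B X p q s cf Hwf Hc Hpc Hs HX; simpl in Hwf.
  - exists 0%nat, cf. simpl. repeat split; auto; try lia; apply Hs.
  - exists 1%nat, (ex cf i). simpl in Hc. apply code_at_cons in Hc as [Hc _].
    rewrite <- Hpc in Hc.
    split; [simpl; lia|]. split; [apply one_step; auto; now intros ->|].
    pose proof Hs as (HB & H3 & H4 & HN & HR & HA & HO).
    destruct i; try discriminate; repeat rewrite andb_true_iff in Hwf;
      simpl len; simpl ex; simpl den;
      (split; [simpl; lia|]);
      rewrite <- ?HN, <- ?HR by tauto;
      try (apply sim_setR; tauto).
    + apply sim_setN; auto. now apply andb_true_iff in Hwf as [? _].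
    + apply sim_setN; auto. destruct Hwf as [[Hw _] _]. now apply andb_true_iff in Hw as [? _].
    + repeat split; simpl; try tauto. now destruct HO as [-> _].
    + repeat split; simpl; try tauto. now destruct HO as [_ ->].
  - cbn [comp] in Hc. rewrite !andb_true_iff, Nat.ltb_lt in Hwf.
    destruct Hwf as [[Hd Hx] Hi].
    apply code_at_app in Hc as [Hc1 Hc2]. apply code_at_cons in Hc2 as [Hc2 _].
    destruct (addr_steps p q x i cf) as (c' & E1 & E2 & E3 & E4); auto.
    exists 7%nat, (ex c' (RLoad d 2)). split; [simpl; lia|].
    simpl length in Hc2. rewrite <- E2 in Hc2.
    split; [apply (nsteps_add p 6 1 _ c'); auto; now apply one_step|].
    split; [simpl; lia|]. specialize (E4 _ _ Hs). simpl.
    pose proof Hs as (HB & H3 & H4 & HN & HR & HA & HO).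
    pose proof E4 as (_ & _ & _ & _ & _ & HA' & _).
    rewrite E3, H3, HN, HA' by auto. now apply sim_setR.
  - cbn [comp] in Hc. rewrite !andb_true_iff, Nat.ltb_lt in Hwf.
    destruct Hwf as [[Hv Hx] Hi].
    apply code_at_app in Hc as [Hc1 Hc2]. apply code_at_cons in Hc2 as [Hc2 _].
    destruct (addr_steps p q x i cf) as (c' & E1 & E2 & E3 & E4); auto.
    exists 7%nat, (ex c' (RStore 2 v)). split; [simpl; lia|].
    simpl length in Hc2. rewrite <- E2 in Hc2.
    split; [apply (nsteps_add p 6 1 _ c'); auto; now apply one_step|].
    split; [simpl; lia|]. specialize (E4 _ _ Hs). simpl.
    pose proof Hs as (HB & H3 & H4 & HN & HR & HA & HO).
    pose proof E4 as (_ & _ & _ & _ & HR' & _ & _).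
    rewrite E3, H3, HN, HR' by auto. now apply sim_store.
  - simpl in Hc. apply andb_true_iff in Hwf as [W1 W2].
    apply code_at_app in Hc as [Hc1 Hc2]. rewrite length_comp in Hc2.
    destruct (IH1 B X p q s cf) as (t1 & cf1 & T1 & E1 & P1 & S1); auto.
    destruct (IH2 B X p (q + len c1)%nat (den c1 s) cf1)
      as (t2 & cf2 & T2 & E2 & P2 & S2); auto.
    { intros r Hr. destruct (den_same c1 s) as (N & _).
      rewrite N; auto. now apply wf_param. }
    exists (t1 + t2)%nat, cf2. simpl. split; [lia|].
    split; [now apply (nsteps_add p _ _ _ cf1)|]. split; [lia|auto].
  - subst q. simpl in Hc. rewrite !andb_true_iff in Hwf.
    destruct Hwf as [[[Ha Hb] W1] W2].
    apply code_at_cons in Hc as [HJ Hc]. apply code_at_app in Hc as [Hc2 Hc].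
    apply code_at_cons in Hc as [HJ' Hc1]. rewrite length_comp in HJ', Hc1.
    replace (pc cf + 1 + len c2 + 1)%nat with (pc cf + 2 + len c2)%nat in Hc1 by lia.
    pose proof (one_step p cf _ HJ ltac:(discriminate)) as E0.
    pose proof Hs as (HB & H3 & H4 & HN & HR & HA & HO).
    cbn [ex] in E0. rewrite !HR in E0 by auto. simpl den.
    destruct (Rle_dec (rr s a) (rr s b)) as [Hle|Hle].
    + destruct (IH1 B X p (pc cf + 2 + len c2)%nat s
        (Config (pc cf + 2 + len c2) (rm cf) (im cf) (out_open cf) (out_sens cf)))
        as (t1 & cf1 & T1 & E1 & P1 & S1); auto.
      exists (1 + t1)%nat, cf1. simpl tb. split; [lia|].
      split; [apply (nsteps_add p 1 t1 _ _ _ E0 E1)|]. simpl len. split; [lia|auto].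
    + destruct (IH2 B X p (pc cf + 1)%nat s
        (Config (S (pc cf)) (rm cf) (im cf) (out_open cf) (out_sens cf)))
        as (t1 & cf1 & T1 & E1 & P1 & S1); auto; [simpl; lia|].
      rewrite <- P1 in HJ'.
      pose proof (one_step p cf1 _ HJ' ltac:(discriminate)) as E2.
      cbn [ex] in E2. unfold jump in E2. rewrite Nat.leb_refl in E2.
      exists (1 + (t1 + 1))%nat. eexists. simpl tb. split; [lia|].
      split; [apply (nsteps_add p 1 _ _ _ _ E0), (nsteps_add p _ _ _ _ _ E1 E2)|].
      simpl. split; [lia|auto].
  - subst q. simpl in Hc. rewrite !andb_true_iff, negb_true_iff in Hwf.
    destruct Hwf as [[[Hi Hn] Hbi] Wb].
    assert (okN i = true) as Hi' by (now apply andb_true_iff in Hi as [? _]).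
    assert (okN n = true) as Hn'.
    { unfold param in Hn. rewrite !orb_true_iff, !Nat.eqb_eq in Hn.
      destruct Hn as [[->| ->]| ->]; reflexivity. }
    apply code_at_cons in Hc as [H0 Hc]. apply code_at_cons in Hc as [H1 Hc].
    apply code_at_app in Hc as [Hcb Hc]. rewrite length_comp in Hc.
    apply code_at_cons in Hc as [H2 Hc]. apply code_at_cons in Hc as [H5 _].
    replace (pc cf + 1 + 1)%nat with (pc cf + 2)%nat in Hcb by lia.
    set (g := fun (k : nat) (s' : mem) => wrN (den b s') i (S k)).
    set (s0 := wrN s i 0).
    (* After [k] rounds control is back at the loop test, one past the initialisation of the
       counter. *)
    assert (forall k, (k <= nr s n)%nat -> exists t cf',
      (t <= 1 + k * (tb b X + 3))%nat /\ nsteps p t cf = Some cf' /\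
      pc cf' = (pc cf + 1)%nat /\ sim B (floop g k s0) cf') as HL.
    { induction k as [|k IHk]; intros Hk.
      - pose proof (one_step p cf _ H0 ltac:(discriminate)) as E.
        exists 1%nat. eexists. split; [lia|]. split; [exact E|].
        split; [simpl; lia|]. now apply sim_setN.
      - destruct IHk as (t & cf1 & T1 & E1 & P1 & S1); [lia|].
        simpl floop. set (s1 := floop g k s0) in *.
        assert (same (For i n b) s s1) as (N1 & _) by apply floop_same.
        assert (nr s1 i = k) as Hk1 by (destruct k; apply updN_eq).
        assert (forall r, param r = true -> nr s1 r = nr s r) as HP.
        { intros r Hr. apply N1. apply wf_param; auto. simpl.
          now rewrite Hi, Hn, Hbi, Wb. }
        rewrite <- P1 in H1. pose proof (one_step p cf1 _ H1 ltac:(discriminate)) as E2.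
        pose proof S1 as (HB & H3 & H4 & HN & _).
        cbn [ex] in E2. rewrite !HN, HP, Hk1 in E2 by auto. unfold jump in E2.
        replace (nr s n <=? k)%nat with false in E2
          by (symmetry; apply Nat.leb_gt; lia).
        destruct (IH B X p (pc cf + 2)%nat s1 (Config (S (pc cf1)) (rm cf1) (im cf1)
          (out_open cf1) (out_sens cf1))) as (t3 & cf3 & T3 & E3 & P3 & S3); auto.
        { simpl; lia. } { intros r Hr. rewrite HP; auto. }
        replace (pc cf + 1 + 1 + len b)%nat with (pc cf3) in H2 by lia.
        pose proof (one_step p cf3 _ H2 ltac:(discriminate)) as E4.
        cbn [ex] in E4. pose proof S3 as (_ & H33 & H43 & HN3 & _).
        replace (im cf3 i) with k in E4.
        2:{ rewrite HN3 by auto. destruct (den_same b s1) as (NN & _). now rewrite NN. }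
        rewrite H43, Nat.add_1_r in E4.
        set (cf4 := setN cf3 i (S k)) in E4.
        replace (pc cf + 1 + 1 + len b + 1)%nat with (pc cf4) in H5 by (simpl; lia).
        pose proof (one_step p cf4 _ H5 ltac:(discriminate)) as E5.
        simpl ex in E5. unfold jump in E5. rewrite Nat.leb_refl in E5.
        exists (t + (1 + (t3 + (1 + 1))))%nat. eexists.
        split; [lia|]. split.
        { apply (nsteps_add p _ _ _ _ _ E1), (nsteps_add p _ _ _ _ _ E2),
            (nsteps_add p _ _ _ _ _ E3), (nsteps_add p _ _ _ _ _ E4 E5). }
        split; [reflexivity|]. apply sim_pc. now apply sim_setN. }
    destruct (HL (nr s n)) as (t & cf1 & T1 & E1 & P1 & S1); auto.
    rewrite <- P1 in H1. pose proof (one_step p cf1 _ H1 ltac:(discriminate)) as E2.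
    pose proof S1 as (_ & _ & _ & HN & _).
    assert (same (For i n b) s (floop g (nr s n) s0)) as (N1 & _) by apply floop_same.
    cbn [ex] in E2. rewrite !HN in E2 by auto.
    replace (nr (floop g (nr s n) s0) i) with (nr s n) in E2
      by (destruct (nr s n); symmetry; apply updN_eq).
    rewrite N1 in E2.
    2:{ apply wf_param; auto. simpl. now rewrite Hi, Hn, Hbi, Wb. }
    unfold jump in E2. rewrite Nat.leb_refl in E2.
    exists (t + 1)%nat. eexists. split.
    { simpl. specialize (HX n Hn). nia. }
    split; [apply (nsteps_add p _ _ _ _ _ E1 E2)|]. split; [simpl; lia|].
    apply sim_pc. exact S1.
Qed.

Fixpoint csz (c : cmd) : nat :=
  match c with
  | Seq c1 c2 => csz c1 + csz c2
  | IfR _ _ c1 c2 => 2 + csz c1 + csz c2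
  | For _ _ b => 5 + csz b
  | _ => 7
  end.

Fixpoint depth (c : cmd) : nat :=
  match c with
  | Seq c1 c2 | IfR _ _ c1 c2 => Nat.max (depth c1) (depth c2)
  | For _ _ b => S (depth b)
  | _ => 0
  end.

(** Each level of nesting multiplies the time by [X]; the factor 2 absorbs the additive overhead of
    a loop into its power. *)
Lemma tb_poly c X : (1 <= X)%nat -> (tb c X <= csz c * (2 * X) ^ depth c)%nat.
Proof.
  intros HX.
  assert (forall a b, (a <= b)%nat -> ((2 * X) ^ a <= (2 * X) ^ b)%nat) as HM
    by (intros; apply Nat.pow_le_mono_r; lia).
  assert (forall a, (1 <= (2 * X) ^ a)%nat) as H1.
  { intros a. apply (Nat.le_trans _ ((2 * X) ^ 0)); [simpl; lia|apply HM; lia]. }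
  induction c as [|i|d x i|x i v|c1 IH1 c2 IH2|a b c1 IH1 c2 IH2|i n b IH];
    cbn [tb csz depth]; try (simpl; lia).
  - pose proof (HM _ _ (Nat.le_max_l (depth c1) (depth c2))).
    pose proof (HM _ _ (Nat.le_max_r (depth c1) (depth c2))). nia.
  - pose proof (HM _ _ (Nat.le_max_l (depth c1) (depth c2))).
    pose proof (HM _ _ (Nat.le_max_r (depth c1) (depth c2))).
    pose proof (H1 (Nat.max (depth c1) (depth c2))). nia.
  - rewrite Nat.pow_succ_r'. specialize (H1 (depth b)). nia.
Qed.

(** * Local search for facility location *)

Lemma sum_ext f g k : (forall i, (i < k)%nat -> f i = g i) -> sum_upto f k = sum_upto g k.
Proof.
  induction k as [|k IH]; simpl; intros H; [reflexivity|].
  rewrite IH, H; auto.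
Qed.

Lemma sum_le f g k : (forall i, (i < k)%nat -> f i <= g i) -> sum_upto f k <= sum_upto g k.
Proof.
  induction k as [|k IH]; simpl; intros H; [lra|].
  apply Rplus_le_compat; auto.
Qed.

Lemma sum_add f g k : sum_upto (fun i => f i + g i) k = sum_upto f k + sum_upto g k.
Proof. induction k as [|k IH]; simpl; [lra|]. rewrite IH. lra. Qed.

Lemma sum_scal a f k : sum_upto (fun i => a * f i) k = a * sum_upto f k.
Proof. induction k as [|k IH]; simpl; [lra|]. rewrite IH. lra. Qed.

Lemma sum_0 k : sum_upto (fun _ => 0) k = 0.
Proof. induction k as [|k IH]; simpl; [lra|]. rewrite IH. lra. Qed.

Lemma sum_const a k : sum_upto (fun _ => a) k = INR k * a.
Proof. induction k as [|k IH]; simpl sum_upto; [simpl; lra|]. rewrite IH, S_INR. lra. Qed.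

Lemma sum_nonneg f k : (forall i, (i < k)%nat -> 0 <= f i) -> 0 <= sum_upto f k.
Proof. intros H. rewrite <- (sum_0 k). now apply sum_le. Qed.

Lemma sum_swap (f : nat -> nat -> R) n m :
  sum_upto (fun i => sum_upto (f i) m) n = sum_upto (fun j => sum_upto (fun i => f i j) n) m.
Proof.
  induction n as [|n IH]; simpl; [now rewrite sum_0|].
  now rewrite IH, sum_add.
Qed.

Lemma sum_single (v : nat -> R) a k :
  sum_upto (fun i => if Nat.eqb i a then v i else 0) k = if Nat.ltb a k then v a else 0.
Proof.
  induction k as [|k IH]; [reflexivity|].
  simpl sum_upto. rewrite IH.
  destruct (Nat.ltb_spec a k), (Nat.ltb_spec a (S k)), (Nat.eqb_spec k a);
    subst; try lia; lra.
Qed.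

Lemma sum_member f a k :
  (forall i, (i < k)%nat -> 0 <= f i) -> (a < k)%nat -> f a <= sum_upto f k.
Proof.
  intros H Ha.
  pose proof (sum_single f a k) as E.
  replace (a <? k)%nat with true in E by (symmetry; now apply Nat.ltb_lt).
  rewrite <- E. apply sum_le. intros i Hi. destruct (Nat.eqb i a); [lra|auto].
Qed.

Definition ind (b : bool) (x : R) : R := if b then x else 0.

(** The default [d] competes even when it lies outside [S]; the result is guaranteed to belong to
    [S] only if [d] does. Ties keep the earlier candidate, exactly as [find_min] does. *)
Fixpoint argmin (S : nat -> bool) (f : nat -> R) (d k : nat) : nat :=
  match k with
  | O => d
  | Datatypes.S k' =>
    let a := argmin S f d k' in
    if S k' then (if Rle_dec (f a) (f k') then a else k') else a
  end.

Lemma argmin_mem S f d k K :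
  (d < K)%nat -> S d = true -> (k <= K)%nat ->
  (argmin S f d k < K)%nat /\ S (argmin S f d k) = true.
Proof.
  intros Hd HS. induction k as [|k IH]; intros Hk; [now split|].
  destruct IH as [H1 H2]; [lia|]. simpl.
  destruct (S k) eqn:E; [|now split].
  destruct (Rle_dec _ _); [now split|]. split; [lia|auto].
Qed.

Lemma argmin_lt S f d k K :
  (d < K)%nat -> (k <= K)%nat -> (argmin S f d k < K)%nat.
Proof.
  intros Hd. induction k as [|k IH]; intros Hk; [easy|].
  specialize (IH ltac:(lia)). simpl.
  destruct (S k); [|easy]. destruct (Rle_dec _ _); lia.
Qed.

Lemma argmin_le S f d k i :
  (i < k)%nat -> S i = true -> f (argmin S f d k) <= f i.
Proof.
  induction k as [|k IH]; intros Hi HS; [lia|]. simpl.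
  destruct (Nat.eq_dec i k) as [->|Hne].
  - rewrite HS. destruct (Rle_dec _ _); lra.
  - specialize (IH ltac:(lia) HS). destruct (S k); auto. destruct (Rle_dec _ _); lra.
Qed.

Lemma find_below (P : nat -> bool) k :
  (exists i, (i < k)%nat /\ P i = true) \/ (forall i, (i < k)%nat -> P i = false).
Proof.
  induction k as [|k IH]; [right; lia|].
  destruct IH as [(i & Hi & HP)|IH]; [left; exists i; split; auto|].
  destruct (P k) eqn:E; [left; exists k; auto|right].
  intros i Hi. destruct (Nat.eq_dec i k) as [->|]; auto. apply IH. lia.
Qed.

(** Testing [o] first makes one move serve three purposes: it only opens [o] when [s] equals [o],
    only closes [s] when [o] is another open station, and exchanges them otherwise. *)
Definition swap (S : nat -> bool) (s o k : nat) : bool :=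
  if Nat.eqb k o then true else if Nat.eqb k s then false else S k.

(** * Approximate local optima of metric facility location *)

Section LocalSearch.
Variables (n m : nat) (w : nat -> bool) (f : nat -> R) (D E : nat -> nat -> R).
Hypothesis f_pos : forall k, (k < m)%nat -> 0 <= f k.
Hypothesis D_pos : forall j k, (j < n)%nat -> (k < m)%nat -> 0 <= D j k.
Hypothesis E_le : forall j o s, (j < n)%nat -> (o < m)%nat -> (s < m)%nat ->
  E o s <= D j o + D j s.
Hypothesis D_le : forall j o s, (j < n)%nat -> (o < m)%nat -> (s < m)%nat ->
  D j s <= D j o + E o s.
Hypothesis D_le' : forall j o s, (j < n)%nat -> (o < m)%nat -> (s < m)%nat ->
  D j o <= D j s + E o s.

Definition fcost (S : nat -> bool) : R := sum_upto (fun k => if S k then f k else 0) m.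
Definition conn (a : nat -> nat) : R := sum_upto (fun j => ind (w j) (D j (a j))) n.

Lemma fcost_swap S s o :
  S s = true -> (s < m)%nat -> (o < m)%nat -> fcost (swap S s o) <= fcost S - f s + f o.
Proof.
  intros HS Hs Ho. unfold fcost.
  pose proof (sum_single f s m) as E1. pose proof (sum_single f o m) as E2.
  apply Nat.ltb_lt in Hs, Ho. rewrite Hs in E1. rewrite Ho in E2.
  rewrite <- E1, <- E2.
  apply (Rplus_le_reg_r (sum_upto (fun i => if Nat.eqb i s then f i else 0) m)).
  match goal with |- _ <= ?a - ?b + ?c + ?d => replace (a - b + c + d) with (a + c) by lra end.
  rewrite <- !sum_add. apply sum_le. intros i Hi. specialize (f_pos i Hi).
  unfold swap. destruct (Nat.eqb_spec i o), (Nat.eqb_spec i s); subst; rewrite ?HS; try lra;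
    repeat match goal with |- context [if ?b then _ else _] => destruct b end; lra.
Qed.

Lemma fcost_drop S s o :
  S s = true -> S o = true -> o <> s -> (s < m)%nat -> fcost (swap S s o) <= fcost S - f s.
Proof.
  intros HS HO Hso Hs. unfold fcost.
  pose proof (sum_single f s m) as E1.
  apply Nat.ltb_lt in Hs. rewrite Hs in E1. rewrite <- E1.
  apply (Rplus_le_reg_r (sum_upto (fun i => if Nat.eqb i s then f i else 0) m)).
  match goal with |- _ <= ?a - ?b + ?b => replace (a - b + b) with a by lra end.
  rewrite <- !sum_add. apply sum_le. intros i Hi.
  unfold swap. destruct (Nat.eqb_spec i o), (Nat.eqb_spec i s); subst; rewrite ?HS, ?HO; try congruence; try lra;
    repeat match goal with |- context [if ?b then _ else _] => destruct b end; lra.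
Qed.

Lemma fcost_add S o : (o < m)%nat -> fcost (swap S o o) <= fcost S + f o.
Proof.
  intros Ho. unfold fcost.
  pose proof (sum_single f o m) as E2.
  apply Nat.ltb_lt in Ho. rewrite Ho in E2. rewrite <- E2, <- sum_add.
  apply sum_le. intros i Hi. specialize (f_pos i Hi).
  unfold swap. destruct (Nat.eqb_spec i o), (S i); lra.
Qed.

Variables (S O : nat -> bool) (sg op : nat -> nat) (e : R).
Hypothesis e_pos : 0 <= e.
Hypothesis sg_mem : forall j, (j < n)%nat -> w j = true -> (sg j < m)%nat /\ S (sg j) = true.
Hypothesis op_mem : forall j, (j < n)%nat -> w j = true -> (op j < m)%nat /\ O (op j) = true.
Hypothesis local_opt : forall s o tau, (s < m)%nat -> (o < m)%nat ->
  (forall j, (j < n)%nat -> w j = true -> (tau j < m)%nat /\ swap S s o (tau j) = true) ->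
  fcost S + conn sg <= fcost (swap S s o) + conn tau + e.

Lemma conn_sub a b : conn a - conn b = sum_upto (fun j => ind (w j) (D j (a j) - D j (b j))) n.
Proof.
  unfold conn.
  transitivity (sum_upto (fun j => ind (w j) (D j (a j)) + (-1) * ind (w j) (D j (b j))) n).
  - rewrite sum_add, sum_scal. lra.
  - apply sum_ext. intros i _. unfold ind. destruct (w i); lra.
Qed.

(** The set [P] of clients sent to the new station is arbitrary: local optimality covers every
    assignment to the new stations, not just the cheapest one. *)
Lemma add_gain (P : nat -> bool) o :
  (o < m)%nat ->
  0 <= f o + e + sum_upto (fun j => ind (w j && P j) (D j o - D j (sg j))) n.
Proof.
  intros Ho.
  set (tau := fun j => if P j then o else sg j).
  pose proof (local_opt o o tau Ho Ho) as H.
  pose proof (fcost_add S o Ho).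
  pose proof (conn_sub tau sg) as HC.
  assert (fcost S + conn sg <= fcost (swap S o o) + conn tau + e) as H1.
  { apply H. intros j Hj Hw. destruct (sg_mem j Hj Hw). unfold tau, swap.
    destruct (P j); [now rewrite Nat.eqb_refl|]. split; auto.
    destruct (Nat.eqb _ _); auto. }
  replace (sum_upto (fun j => ind (w j && P j) (D j o - D j (sg j))) n)
    with (conn tau - conn sg); [lra|].
  rewrite HC. apply sum_ext. intros j _. unfold tau, ind.
  destruct (w j), (P j); simpl; lra.
Qed.

Lemma sum_by_op (P : nat -> bool) (v : nat -> R) :
  sum_upto (fun o => sum_upto (fun j => ind (w j && (P o && Nat.eqb (op j) o)) (v j)) n) m
  = sum_upto (fun j => ind (w j && P (op j)) (v j)) n.
Proof.
  rewrite sum_swap. apply sum_ext. intros j Hj.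
  destruct (w j) eqn:Hw; simpl; [|apply sum_0].
  destruct (op_mem j Hj Hw) as [Ho _].
  transitivity (sum_upto (fun o => if Nat.eqb o (op j) then ind (P o) (v j) else 0) m).
  - apply sum_ext. intros o _. rewrite (Nat.eqb_sym o).
    destruct (Nat.eqb _ _), (P o); reflexivity.
  - rewrite sum_single. apply Nat.ltb_lt in Ho. now rewrite Ho.
Qed.

(** Open each station of [O] in turn for exactly the clients that [op] sends there. Every client
    moves in just one of these moves, so the gains add up to the whole difference of connection
    costs, with one error [e] per station. *)
Lemma conn_bound : conn sg <= conn op + fcost O + INR m * e.
Proof.
  assert (0 <= sum_upto (fun o => ind (O o) (f o) + e +
    sum_upto (fun j => ind (w j && (O o && Nat.eqb (op j) o)) (D j (op j) - D j (sg j))) n) m) as H.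
  { apply sum_nonneg. intros o Ho.
    destruct (O o) eqn:HO; simpl.
    - pose proof (add_gain (fun j => Nat.eqb (op j) o) o Ho) as H.
      cbv beta in H. erewrite sum_ext; [exact H|].
      intros j _. simpl. destruct (Nat.eqb_spec (op j) o) as [->|]; [reflexivity|].
      now rewrite andb_false_r.
    - erewrite (sum_ext _ (fun _ => 0)); [rewrite sum_0; lra|].
      intros j _. now rewrite andb_false_r. }
  rewrite sum_add, sum_add, sum_const, sum_by_op in H.
  pose proof (conn_sub op sg) as HC.
  replace (sum_upto (fun j => ind (w j && O (op j)) (D j (op j) - D j (sg j))) n)
    with (conn op - conn sg) in H.
  - unfold fcost. unfold ind in H at 1. lra.
  - rewrite HC. apply sum_ext. intros j Hj. destruct (w j) eqn:Hw; [|reflexivity].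
    destruct (op_mem j Hj Hw) as [_ ->]. reflexivity.
Qed.

Variable eta : nat -> nat.
Hypothesis eta_mem : forall o, (o < m)%nat -> O o = true ->
  (eta o < m)%nat /\ S (eta o) = true.
Hypothesis eta_le : forall o s, (o < m)%nat -> O o = true -> (s < m)%nat -> S s = true ->
  E o (eta o) <= E o s.

(** The open station nearest to [op j] is no farther from it than [sg j], and the triangle
    inequality through client [j] bounds that distance. *)
Lemma reroute j : (j < n)%nat -> w j = true ->
  D j (eta (op j)) <= 2 * D j (op j) + D j (sg j).
Proof.
  intros Hj Hw. destruct (op_mem j Hj Hw) as [Ho HO]. destruct (sg_mem j Hj Hw) as [Hs HS].
  destruct (eta_mem _ Ho HO) as [He _].
  pose proof (D_le j (op j) (eta (op j)) Hj Ho He).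
  pose proof (eta_le _ _ Ho HO Hs HS).
  pose proof (E_le j (op j) (sg j) Hj Ho Hs). lra.
Qed.

(* Closing s: its clients move to the open station nearest to their optimal
   one. If s itself is that station for some optimal stations, s is exchanged for the
   closest of these, o1; adding the gains of opening the others pays for
   sending their clients to o1. *)
Lemma close_bound s : (s < m)%nat -> S s = true -> (exists o, (o < m)%nat /\ O o = true) ->
  f s <= sum_upto (fun o => ind (O o && Nat.eqb (eta o) s) (f o + e)) m + e
         + sum_upto (fun j => ind (w j && Nat.eqb (sg j) s) (2 * D j (op j))) n.
Proof.
  intros Hs HS (o0 & Ho0 & HO0).
  set (P := fun o => O o && Nat.eqb (eta o) s).
  change (sum_upto (fun o => ind (O o && Nat.eqb (eta o) s) (f o + e)) m)
    with (sum_upto (fun o => ind (P o) (f o + e)) m).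
  assert ((exists o, (o < m)%nat /\ P o = true) \/ (forall o, (o < m)%nat -> P o = false))
    as [(o' & Ho' & HP')|HP].
  { apply find_below. }
  - set (o1 := argmin P (fun o => E o s) o' m).
    destruct (argmin_mem P (fun o => E o s) o' m m Ho' HP' (Nat.le_refl _)) as [Ho1 HP1].
    assert (forall o, (o < m)%nat -> P o = true -> E o1 s <= E o s) as Hmin.
    { intros o Ho HP. now apply (argmin_le P (fun o => E o s)). }
    fold o1 in Ho1, HP1. clearbody o1.
    set (tau := fun j => if Nat.eqb (sg j) s then
                           if Nat.eqb (eta (op j)) s then o1 else eta (op j) else sg j).
    assert (fcost S + conn sg <= fcost (swap S s o1) + conn tau + e) as H1.
    { apply local_opt; auto. intros j Hj Hw.
      destruct (sg_mem j Hj Hw) as [? Hsg]. destruct (op_mem j Hj Hw) as [Ho HO].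
      destruct (eta_mem _ Ho HO) as [He HSe]. unfold tau, swap.
      destruct (Nat.eqb_spec (sg j) s) as [_|Hne].
      - destruct (Nat.eqb_spec (eta (op j)) s) as [_|Hne].
        + now rewrite Nat.eqb_refl.
        + split; auto. destruct (Nat.eqb _ o1); auto.
          destruct (Nat.eqb_spec (eta (op j)) s); auto; congruence.
      - split; auto. destruct (Nat.eqb (sg j) o1); auto.
        destruct (Nat.eqb_spec (sg j) s); auto; congruence. }
    pose proof (fcost_swap S s o1 HS Hs Ho1) as H2.
    pose proof (conn_sub tau sg) as H3.
    set (Q := fun o => P o && negb (Nat.eqb o o1)).
    assert (0 <= sum_upto (fun o => ind (Q o) (f o + e) +
      sum_upto (fun j => ind (w j && (Q o && Nat.eqb (op j) o))
        (ind (Nat.eqb (sg j) s) (D j (op j) - D j (sg j)))) n) m) as H4.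
    { apply sum_nonneg. intros o Ho. destruct (Q o) eqn:HQ; simpl.
      - pose proof (add_gain (fun j => Nat.eqb (op j) o && Nat.eqb (sg j) s) o Ho) as H.
        erewrite sum_ext; [exact H|]. intros j _. simpl.
        destruct (Nat.eqb_spec (op j) o) as [->|]; simpl; [|now rewrite andb_false_r].
        destruct (w j), (Nat.eqb (sg j) s); reflexivity.
      - erewrite (sum_ext _ (fun _ => 0)); [rewrite sum_0; lra|].
        intros j _. now rewrite andb_false_r. }
    rewrite sum_add, sum_by_op in H4.
    assert (sum_upto (fun o => ind (P o) (f o + e)) m
      = sum_upto (fun o => ind (Q o) (f o + e)) m + (f o1 + e)) as H5.
    { pose proof (sum_single (fun o => f o + e) o1 m) as H. apply Nat.ltb_lt in Ho1.
      rewrite Ho1 in H. rewrite <- H, <- sum_add. apply sum_ext. intros o _.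
      unfold Q. destruct (Nat.eqb_spec o o1) as [->|]; simpl.
      - rewrite HP1. simpl. lra.
      - rewrite andb_true_r. lra. }
    rewrite H5.
    enough (conn tau - conn sg +
      sum_upto (fun j => ind (w j && Q (op j))
        (ind (Nat.eqb (sg j) s) (D j (op j) - D j (sg j)))) n <=
      sum_upto (fun j => ind (w j && Nat.eqb (sg j) s) (2 * D j (op j))) n) by lra.
    rewrite H3, <- sum_add. apply sum_le. intros j Hj.
    destruct (w j) eqn:Hw; simpl; [|lra].
    destruct (sg_mem j Hj Hw) as [? Hsg]. destruct (op_mem j Hj Hw) as [Ho HO].
    pose proof (reroute j Hj Hw) as Hr. unfold Q, P, tau. rewrite HO. simpl.
    pose proof (D_pos j (op j) Hj Ho). pose proof (D_pos j (sg j) Hj ltac:(auto)).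
    destruct (Nat.eqb_spec (sg j) s) as [Es|Es]; simpl.
    + destruct (Nat.eqb_spec (eta (op j)) s) as [Ee|Ee]; simpl; [|lra].
      destruct (Nat.eqb_spec (op j) o1) as [Eo|Eo]; simpl; [rewrite Eo in *; lra|].
      assert (P (op j) = true) as HPj.
      { unfold P. rewrite HO. now apply Nat.eqb_eq. }
      pose proof (Hmin _ Ho HPj).
      (* By the choice of [o1], [E o1 s] is at most [E (op j) s], hence at most
         [D j (op j) + D j s]. Moving [j] from [s] to [o1] thus adds at most [D j s + D j (op j)],
         and the term [D j (op j) - D j s] from opening [op j] leaves [2 * D j (op j)]. *)
      assert (D j o1 <= D j s + E o1 s) as Hd.
      { now apply D_le'. }
      pose proof (E_le j (op j) s Hj Ho Hs). rewrite Es in *. lra.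
    + destruct (Nat.eqb _ _ && _); simpl; lra.
  - destruct (eta_mem o0 Ho0 HO0) as [He0 HSe0].
    assert (forall o, (o < m)%nat -> O o = true -> eta o <> s) as Hne.
    { intros o Ho HO E1. specialize (HP o Ho). unfold P in HP.
      rewrite HO, E1, Nat.eqb_refl in HP. discriminate. }
    set (tau := fun j => if Nat.eqb (sg j) s then eta (op j) else sg j).
    (* The station [eta o0] is already open and differs from [s], so this move is a pure closing. *)
    assert (fcost S + conn sg <= fcost (swap S s (eta o0)) + conn tau + e) as H1.
    { apply local_opt; auto. intros j Hj Hw.
      destruct (sg_mem j Hj Hw) as [? Hsg]. destruct (op_mem j Hj Hw) as [Ho HO].
      destruct (eta_mem _ Ho HO) as [He HSe]. unfold tau, swap.
      destruct (Nat.eqb_spec (sg j) s) as [_|Hne'].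
      - split; auto. destruct (Nat.eqb _ (eta o0)); auto.
        destruct (Nat.eqb_spec (eta (op j)) s); auto. now destruct (Hne (op j)).
      - split; auto. destruct (Nat.eqb (sg j) (eta o0)); auto.
        destruct (Nat.eqb_spec (sg j) s); auto; congruence. }
    pose proof (fcost_drop S s (eta o0) HS HSe0 (Hne o0 Ho0 HO0) Hs) as H2.
    pose proof (conn_sub tau sg) as H3.
    assert (0 <= sum_upto (fun o => ind (P o) (f o + e)) m) as H4.
    { apply sum_nonneg. intros o Ho. specialize (f_pos o Ho). destruct (P o); simpl; lra. }
    enough (conn tau - conn sg <=
      sum_upto (fun j => ind (w j && Nat.eqb (sg j) s) (2 * D j (op j))) n) by lra.
    rewrite H3. apply sum_le. intros j Hj.
    destruct (w j) eqn:Hw; simpl; [|lra].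
    pose proof (reroute j Hj Hw). unfold tau.
    destruct (Nat.eqb_spec (sg j) s); simpl; lra.
Qed.

(** Summing [close_bound] over the open [s] counts each station of [O] at its single [eta o] and
    each client at its single [sg j]. One error per closed station and one per station of [O] give
    at most 2m errors. *)
Lemma facility_bound : (exists o, (o < m)%nat /\ O o = true) ->
  fcost S <= fcost O + 2 * conn op + 2 * INR m * e.
Proof.
  intros Hex.
  assert (fcost S <= sum_upto (fun s =>
    sum_upto (fun o => ind (O o && Nat.eqb (eta o) s) (f o + e)) m + e
    + sum_upto (fun j => ind (w j && Nat.eqb (sg j) s) (2 * D j (op j))) n) m) as H.
  { apply sum_le. intros s Hs. destruct (S s) eqn:HS; [now apply close_bound|].
    assert (0 <= sum_upto (fun o => ind (O o && Nat.eqb (eta o) s) (f o + e)) m).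
    { apply sum_nonneg. intros o Ho. specialize (f_pos o Ho). destruct (_ && _); simpl; lra. }
    assert (0 <= sum_upto (fun j => ind (w j && Nat.eqb (sg j) s) (2 * D j (op j))) n).
    { apply sum_nonneg. intros j Hj. destruct (w j) eqn:Hw; simpl; [|lra].
      destruct (op_mem j Hj Hw) as [Ho HO].
      pose proof (D_pos j (op j) Hj Ho). destruct (Nat.eqb _ _); simpl; lra. }
    lra. }
  rewrite !sum_add, sum_const, (sum_swap _ m m), (sum_swap _ m n) in H.
  assert (sum_upto (fun j => sum_upto (fun s => ind (w j && Nat.eqb (sg j) s) (2 * D j (op j))) m) n
    <= 2 * conn op) as H1.
  { unfold conn. rewrite <- sum_scal. apply sum_le. intros j Hj.
    destruct (w j) eqn:Hw; simpl.
    - destruct (op_mem j Hj Hw) as [Ho HO]. pose proof (D_pos j (op j) Hj Ho).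
      rewrite (sum_ext _ (fun s => if Nat.eqb s (sg j) then 2 * D j (op j) else 0)).
      + rewrite (sum_single (fun _ => 2 * D j (op j))). destruct (_ <? _)%nat; lra.
      + intros s _. rewrite Nat.eqb_sym. destruct (Nat.eqb _ _); reflexivity.
    - rewrite sum_0. lra. }
  assert (sum_upto (fun o => sum_upto (fun s => ind (O o && Nat.eqb (eta o) s) (f o + e)) m) m
    <= fcost O + INR m * e) as H2.
  { rewrite <- sum_const. unfold fcost. rewrite <- sum_add. apply sum_le. intros o Ho.
    specialize (f_pos o Ho). destruct (O o) eqn:HO; simpl.
    - rewrite (sum_ext _ (fun s => if Nat.eqb s (eta o) then f o + e else 0)).
      + rewrite (sum_single (fun _ => f o + e)). destruct (_ <? _)%nat; lra.
      + intros s _. rewrite Nat.eqb_sym. destruct (Nat.eqb _ _); reflexivity.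
    - rewrite sum_0. lra. }
  lra.
Qed.
End LocalSearch.

(** * Local search with a fixed number of sweeps *)

Section Descent.
Variables (n m : nat) (w : nat -> bool) (f : nat -> R) (D E : nat -> nat -> R).
Hypothesis m_pos : (0 < m)%nat.
Hypothesis f_pos : forall k, (k < m)%nat -> 0 <= f k.
Hypothesis D_pos : forall j k, (j < n)%nat -> (k < m)%nat -> 0 <= D j k.
Hypothesis E_le : forall j o s, (j < n)%nat -> (o < m)%nat -> (s < m)%nat ->
  E o s <= D j o + D j s.
Hypothesis D_le : forall j o s, (j < n)%nat -> (o < m)%nat -> (s < m)%nat ->
  D j s <= D j o + E o s.
Hypothesis D_le' : forall j o s, (j < n)%nat -> (o < m)%nat -> (s < m)%nat ->
  D j o <= D j s + E o s.

(** After a move the default [d] is the station just opened, so the nearest open station is found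
    without first searching for an open one. *)
Definition Phi (S : nat -> bool) (d : nat) : R :=
  fcost m f S + conn n w D (fun j => argmin S (D j) d m).

Definition trial (Q : R) (o s : nat) (a : (nat -> bool) * R) : (nat -> bool) * R :=
  let T := swap (fst a) s o in
  if Rle_dec (Phi T o * Q) (snd a * (Q - 1)) then (T, Phi T o) else a.

Definition sweep (Q : R) (a : (nat -> bool) * R) : (nat -> bool) * R :=
  floop (fun s a => floop (fun o a => trial Q o s a) m a) m a.

Definition serves (S : nat -> bool) (sg : nat -> nat) : Prop :=
  forall j, (j < n)%nat -> w j = true -> (sg j < m)%nat /\ S (sg j) = true.

(** The stored cost is only an upper bound: the initial one charges a station once for every client
    that favours it. *)
Definition bounded (a : (nat -> bool) * R) : Prop :=
  exists sg, serves (fst a) sg /\ fcost m f (fst a) + conn n w D sg <= snd a.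

Definition rejects (Q : R) (a : (nat -> bool) * R) (s o : nat) : Prop :=
  snd a * (Q - 1) < Phi (swap (fst a) s o) o * Q.

Definition favourite (i : nat) : nat :=
  argmin (fun _ => true) (fun k => f k + D i k) 0 m.

Definition init_cost (k : nat) : R :=
  sum_upto (fun j => ind (w j) (f (favourite j) + D j (favourite j))) k.

Definition init_set (k : nat) : nat -> bool :=
  floop (fun i S => if w i then swap S (favourite i) (favourite i) else S) k
    (fun _ => false).

(** After [t] sweeps that each shrink the cost by 1 - 1/[Q], Bernoulli's inequality bounds the cost
    by [c0] times [Q]/([Q] + [t]). This rational form stands in for the power, so no exponential or
    logarithm occurs. *)
Definition descended (Q c0 t : R) (a : (nat -> bool) * R) : Prop :=
  bounded a /\ snd a <= c0 /\
  (snd a * (Q + t) <= c0 * Q \/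
   forall s o, (s < m)%nat -> (o < m)%nat -> rejects Q a s o).

Lemma fcost_nonneg S : 0 <= fcost m f S.
Proof. apply sum_nonneg. intros k Hk. specialize (f_pos k Hk). destruct (S k); lra. Qed.

Lemma conn_nonneg S sg : serves S sg -> 0 <= conn n w D sg.
Proof.
  intros H. apply sum_nonneg. intros j Hj. destruct (w j) eqn:Hw; simpl; [|lra].
  apply D_pos; auto. now apply H.
Qed.

Lemma bounded_nonneg a : bounded a -> 0 <= snd a.
Proof.
  intros (sg & H1 & H2). pose proof (fcost_nonneg (fst a)).
  pose proof (conn_nonneg _ _ H1). lra.
Qed.

Lemma argmin_serves S d : (d < m)%nat -> S d = true -> serves S (fun j => argmin S (D j) d m).
Proof. intros Hd HS j _ _. now apply argmin_mem. Qed.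

Lemma conn_argmin S d sg : serves S sg ->
  conn n w D (fun j => argmin S (D j) d m) <= conn n w D sg.
Proof.
  intros H. apply sum_le. intros j Hj. destruct (w j) eqn:Hw; simpl; [|lra].
  destruct (H j Hj Hw). now apply argmin_le.
Qed.

Lemma swap_new S s o : swap S s o o = true.
Proof. unfold swap. now rewrite Nat.eqb_refl. Qed.

Lemma trial_spec Q a s o : 1 <= Q -> (o < m)%nat -> bounded a ->
  bounded (trial Q o s a) /\ snd (trial Q o s a) <= snd a /\
  ((trial Q o s a = a /\ rejects Q a s o) \/
   snd (trial Q o s a) * Q <= snd a * (Q - 1)).
Proof.
  intros HQ Ho Ha. pose proof (bounded_nonneg a Ha). unfold trial.
  destruct (Rle_dec _ _) as [H1|H1]; simpl.
  - split.
    + exists (fun j => argmin (swap (fst a) s o) (D j) o m). simpl.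
      split; [|unfold Phi; lra]. apply argmin_serves; auto. apply swap_new.
    + split; [|now right].
      apply (Rmult_le_reg_r Q); [lra|]. nra.
  - split; auto. split; [lra|]. left. split; auto. unfold rejects. lra.
Qed.

Definition swept (Q : R) (a0 a : (nat -> bool) * R) (P : nat -> nat -> Prop) : Prop :=
  bounded a /\ snd a <= snd a0 /\
  ((a = a0 /\ forall s o, P s o -> rejects Q a0 s o) \/
   snd a * Q <= snd a0 * (Q - 1)).

(** If no move is accepted, every test was made against the same [a0], which is then stuck for all
    pairs. Otherwise the first acceptance gives the required drop, and later moves never raise the
    cost. *)
Lemma sweep_swept Q a0 : 1 <= Q -> bounded a0 ->
  swept Q a0 (sweep Q a0) (fun s o => (s < m)%nat /\ (o < m)%nat).
Proof.
  intros HQ H0. unfold sweep.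
  assert (forall i, (i <= m)%nat -> swept Q a0
    (floop (fun s a => floop (fun o a => trial Q o s a) m a) i a0)
    (fun s o => (s < i)%nat /\ (o < m)%nat)) as H; [|now apply H].
  induction i as [|i IH]; intros Hi.
  { split; auto. split; [simpl; lra|]. left. split; auto. intros; lia. }
  specialize (IH ltac:(lia)). simpl.
  set (a1 := floop _ i a0) in *. clearbody a1.
  assert (forall j, (j <= m)%nat -> swept Q a0 (floop (fun o a => trial Q o i a) j a1)
    (fun s o => ((s < i)%nat /\ (o < m)%nat) \/ (s = i /\ (o < j)%nat))) as H.
  { induction j as [|j IHj]; intros Hj.
    - simpl. destruct IH as (B1 & B2 & [[B3 B4]|B3]).
      + split; auto. split; auto. left. split; auto.
        intros s o [H|H]; [auto|lia].
      + split; auto.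
    - specialize (IHj ltac:(lia)). simpl. set (a2 := floop _ j a1) in *. clearbody a2.
      destruct IHj as (B1 & B2 & B3).
      destruct (trial_spec Q a2 i j HQ ltac:(lia) B1) as (C1 & C2 & C3).
      split; auto. split; [lra|].
      destruct B3 as [[-> B4]|B3].
      + destruct C3 as [[C3 C4]|C3]; [left|now right]. split; auto.
        intros s o [H|[-> H]]; [auto|].
        destruct (Nat.eq_dec o j) as [->|]; auto. apply B4. right. lia.
      + right. pose proof (bounded_nonneg _ C1). nra. }
  destruct (H m (Nat.le_refl m)) as (B1 & B2 & [[B3 B4]|B3]); split; auto; split; auto.
  left. split; auto. intros s o [H1 H2]. apply B4. lia.
Qed.

Lemma floop_fixed {A} (g : nat -> A -> A) k a :
  (forall i, (i < k)%nat -> g i a = a) -> floop g k a = a.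
Proof. induction k as [|k IH]; simpl; intros H; [reflexivity|]. rewrite IH; auto. Qed.

(** This makes the surplus sweeps harmless once the search is stuck. *)
Lemma sweep_fixed Q a :
  (forall s o, (s < m)%nat -> (o < m)%nat -> rejects Q a s o) -> sweep Q a = a.
Proof.
  intros H. unfold sweep. apply floop_fixed. intros s Hs. apply floop_fixed. intros o Ho.
  specialize (H s o Hs Ho). unfold rejects in H. unfold trial.
  destruct (Rle_dec _ _); [lra|reflexivity].
Qed.

Lemma sweep_descended Q c0 t a : 1 <= Q -> 0 <= t ->
  descended Q c0 t a -> descended Q c0 (t + 1) (sweep Q a).
Proof.
  intros HQ Ht (A1 & A2 & [A3|A3]).
  - destruct (sweep_swept Q a HQ A1) as (B1 & B2 & B3).
    split; auto. split; [lra|].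
    destruct B3 as [[-> B3]|B3]; [right; intros; now apply B3|].
    pose proof (bounded_nonneg _ A1). pose proof (bounded_nonneg _ B1).
    left. apply (Rmult_le_reg_r Q); [lra|].
    (* The next comparison rests on ([Q] - 1)([Q] + [t] + 1) = [Q]([Q] + [t]) - [t] - 1. *)
    apply (Rle_trans _ (snd a * (Q - 1) * (Q + t + 1))); [nra|].
    apply (Rle_trans _ (snd a * (Q + t) * Q)); [nra|].
    apply Rmult_le_compat_r; lra.
  - rewrite (sweep_fixed Q a) by auto. split; auto.
Qed.

Lemma init_serves k : (k <= n)%nat ->
  (forall j, (j < k)%nat -> w j = true ->
     (favourite j < m)%nat /\ init_set k (favourite j) = true) /\
  fcost m f (init_set k) <= sum_upto (fun j => ind (w j) (f (favourite j))) k.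
Proof.
  assert (forall j, (favourite j < m)%nat) as HN by (intros; now apply argmin_lt).
  induction k as [|k IH]; intros Hk.
  { split; [lia|]. unfold fcost. simpl. rewrite sum_0. lra. }
  destruct IH as [I1 I2]; [lia|]. unfold init_set in *. simpl.
  set (S := floop _ k _) in *. clearbody S. destruct (w k) eqn:Hw; simpl.
  - split.
    + intros j Hj Hwj. split; auto. unfold swap.
      destruct (Nat.eqb_spec (favourite j) (favourite k)); auto.
      destruct (Nat.eq_dec j k) as [->|]; [congruence|]. apply I1; auto; lia.
    + pose proof (fcost_add m f f_pos S (favourite k) (HN k)). lra.
  - split; [|lra]. intros j Hj Hwj. destruct (Nat.eq_dec j k) as [->|]; [congruence|].
    apply I1; auto; lia.
Qed.

Lemma init_descended Q : 0 <= Q -> descended Q (init_cost n) 0 (init_set n, init_cost n).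
Proof.
  intros HQ. destruct (init_serves n (Nat.le_refl n)) as [H1 H2].
  split; [|split; simpl; [lra|left; lra]].
  exists favourite. split; [exact H1|]. simpl. unfold init_cost, conn.
  assert (forall x y z, x <= y -> x + z <= y + z) as H by (intros; lra).
  rewrite (sum_ext (fun j => ind (w j) (f (favourite j) + D j (favourite j)))
    (fun j => ind (w j) (f (favourite j)) + ind (w j) (D j (favourite j)))).
  - rewrite sum_add. now apply H.
  - intros j _. unfold ind. destruct (w j); lra.
Qed.

Variables (O : nat -> bool) (op : nat -> nat).
Hypothesis op_mem : serves O op.

(** A client pays at its favourite station no more than the opening and connection cost at [op j],
    both of which are part of the total cost of [O]. *)
Lemma init_cost_le : init_cost n <= INR n * (fcost m f O + conn n w D op).
Proof.
  rewrite <- sum_const. apply sum_le. intros j Hj.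
  pose proof (fcost_nonneg O). pose proof (conn_nonneg _ _ op_mem).
  destruct (w j) eqn:Hw; simpl; [|lra].
  destruct (op_mem j Hj Hw) as [Ho HO].
  pose proof (argmin_le (fun _ => true) (fun k => f k + D j k) 0 m (op j) Ho eq_refl) as H1.
  fold (favourite j) in H1. simpl in H1.
  assert (f (op j) <= fcost m f O) as H2.
  { pose proof (sum_member (fun k => if O k then f k else 0) (op j) m) as H2.
    simpl in H2. rewrite HO in H2. apply H2; auto.
    intros i Hi. specialize (f_pos i Hi). destruct (O i); lra. }
  assert (D j (op j) <= conn n w D op) as H3.
  { pose proof (sum_member (fun j => ind (w j) (D j (op j))) j n) as H3.
    simpl in H3. rewrite Hw in H3. simpl in H3. apply H3; auto.
    intros i Hi. destruct (w i) eqn:Hwi; simpl; [|lra]. apply D_pos; auto. now apply op_mem. }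
  lra.
Qed.

(** Write A for the stored cost, F, C for the costs of the set reached, F_O, C_O for those of [O],
    and e = A/(64m). When the search is stuck, F + 4.6 C is at most 5.6 F_O + 6.6 C_O + 6.6 m e. As
    A is at most F + C + e, it is at most 16/15 of 2 F_O + 3 C_O, so the error is at most 0.22 F_O +
    0.33 C_O, within the rounding to 6 and 7. *)
Lemma descent_bound a d :
  descended (64 * INR m) (init_cost n) (INR n * (64 * INR m)) a ->
  ((exists k, (k < m)%nat /\ fst a k = true) -> (d < m)%nat /\ fst a d = true) ->
  fcost m f (fst a) + 46 / 10 * conn n w D (fun j => argmin (fst a) (D j) d m)
  <= 6 * fcost m f O + 7 * conn n w D op.
Proof.
  intros (A1 & A2 & A3) Hd.
  set (sg := fun j => argmin (fst a) (D j) d m).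
  pose proof (fcost_nonneg O) as HF. pose proof (conn_nonneg _ _ op_mem) as HC.
  pose proof (fcost_nonneg (fst a)) as HFa. pose proof (bounded_nonneg a A1) as Hca.
  assert (1 <= INR m) as Hm1 by (apply (le_INR 1); lia).
  destruct A1 as (sg0 & S0 & B0).
  assert (serves (fst a) sg) as Hsg.
  { intros j Hj Hw. destruct (S0 j Hj Hw) as [H1 H2].
    apply argmin_serves; auto; apply Hd; eauto. }
  pose proof (conn_argmin (fst a) d sg0 S0) as Hsg0. fold sg in Hsg0.
  pose proof (conn_nonneg _ _ Hsg) as HCa.
  (* Here F + 4.6 C is at most 4.6 (F + C), hence at most 4.6 times the stored cost. *)
  assert (snd a <= fcost m f O + conn n w D op ->
    fcost m f (fst a) + 46 / 10 * conn n w D sg <= 6 * fcost m f O + 7 * conn n w D op)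
    as Hsmall by (intros; lra).
  destruct A3 as [A3|A3].
  - apply Hsmall. pose proof init_cost_le as H.
    pose proof (pos_INR n) as Hn.
    (* With [t] equal to n times 64m, the cost has shrunk by the factor n + 1, more than the factor
       n lost at the start. *)
    assert (snd a * (1 + INR n) <= init_cost n) as H1.
    { apply (Rmult_le_reg_r (64 * INR m)); [lra|]. nra. }
    destruct (Req_dec (INR n) 0) as [E0|E0]; [rewrite E0 in *; nra|].
    apply (Rmult_le_reg_r (1 + INR n)); [lra|]. nra.
  - assert ((exists j, (j < n)%nat /\ w j = true) \/ (forall j, (j < n)%nat -> w j = false))
      as [(j0 & Hj0 & Hw0)|Hnone].
    { apply find_below. }
    2:{ apply Hsmall. enough (init_cost n = 0) by lra. unfold init_cost.
        rewrite (sum_ext _ (fun _ => 0)), sum_0; auto.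
        intros j Hj. now rewrite Hnone. }
    destruct (S0 j0 Hj0 Hw0) as [Hk0 HSk0].
    set (e := snd a / (64 * INR m)).
    assert (0 <= e) as He.
    { unfold e. apply Rmult_le_pos; auto. left. apply Rinv_0_lt_compat. lra. }
    assert (INR m * e = snd a / 64) as Hme by (unfold e; field; lra).
    assert (forall s o tau, (s < m)%nat -> (o < m)%nat -> serves (swap (fst a) s o) tau ->
      snd a <= fcost m f (swap (fst a) s o) + conn n w D tau + e) as Hloc.
    { intros s o tau Hs Ho Ht. specialize (A3 s o Hs Ho). unfold rejects, Phi in A3.
      pose proof (conn_argmin (swap (fst a) s o) o tau Ht).
      apply (Rmult_le_reg_r (64 * INR m)); [lra|].
      replace ((fcost m f (swap (fst a) s o) + conn n w D tau + e) * (64 * INR m))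
        with ((fcost m f (swap (fst a) s o) + conn n w D tau) * (64 * INR m) + snd a)
        by (unfold e; field; lra).
      assert (fcost m f (swap (fst a) s o) * (64 * INR m) +
        conn n w D (fun j => argmin (swap (fst a) s o) (D j) o m) * (64 * INR m) <=
        fcost m f (swap (fst a) s o) * (64 * INR m) + conn n w D tau * (64 * INR m)).
      { apply Rplus_le_compat_l, Rmult_le_compat_r; lra. }
      lra. }
    assert (forall k, swap (fst a) (sg0 j0) (sg0 j0) k = fst a k) as Hsame.
    { intros k. unfold swap. destruct (Nat.eqb_spec k (sg0 j0)) as [->|]; auto. }
    (* Exchanging an open station for itself changes nothing; the rejection of this move shows that
       the stored bound exceeds the true cost by at most [e]. *)
    assert (snd a <= fcost m f (fst a) + conn n w D sg + e) as Hcur.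
    { replace (fcost m f (fst a)) with (fcost m f (swap (fst a) (sg0 j0) (sg0 j0))).
      - apply Hloc; auto. intros j Hj Hw. rewrite Hsame. now apply Hsg.
      - unfold fcost. apply sum_ext. intros i _. now rewrite Hsame. }
    set (eta := fun o => argmin (fst a) (E o) (sg0 j0) m).
    assert (forall s o tau, (s < m)%nat -> (o < m)%nat -> serves (swap (fst a) s o) tau ->
      fcost m f (fst a) + conn n w D sg <= fcost m f (swap (fst a) s o) + conn n w D tau + e) as Hloc'.
    { intros s o tau Hs Ho Ht. specialize (Hloc s o tau Hs Ho Ht). lra. }
    pose proof (conn_bound n m w f D f_pos (fst a) O sg op e He Hsg op_mem Hloc') as Hc.
    assert (fcost m f (fst a) <= fcost m f O + 2 * conn n w D op + 2 * INR m * e) as Hf.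
    { apply (facility_bound n m w f D E f_pos D_pos E_le D_le D_le' (fst a) O sg op e He Hsg
        op_mem Hloc' eta).
      - intros o Ho HO. now apply argmin_mem.
      - intros o s Ho HO Hs HS. now apply argmin_le.
      - exists (op j0). now apply op_mem. }
    assert (e <= INR m * e) by nra.
    lra.
Qed.
End Descent.

(** * Covering a half disc, separated targets *)

Lemma dist_pos p q : 0 <= dist p q.
Proof. apply sqrt_pos. Qed.

Lemma dist_sym p q : dist p q = dist q p.
Proof. unfold dist. f_equal. ring. Qed.

Lemma dist_triangle p q s : dist p s <= dist p q + dist q s.
Proof.
  pose proof (triangle (fst p) (snd p) (fst s) (snd s) (fst q) (snd q)) as H.
  unfold dist_euc in H. rewrite !Rsqr_pow2 in H. exact H.
Qed.

Lemma dist_refl p : dist p p = 0.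
Proof. unfold dist. rewrite !Rminus_diag. rewrite pow_ne_zero, Rplus_0_r by lia. apply sqrt_0. Qed.

Lemma dist_le p q a : 0 <= a ->
  (fst p - fst q) ^ 2 + (snd p - snd q) ^ 2 <= a ^ 2 <-> dist p q <= a.
Proof.
  intros Ha. unfold dist. split; intros H.
  - rewrite <- (sqrt_pow2 a) by auto. now apply sqrt_le_1_alt.
  - pose proof (pow_incr _ a 2 (conj (sqrt_pos _) H)) as H1.
    rewrite pow2_sqrt in H1; auto.
    apply Rplus_le_le_0_compat; apply pow2_ge_0.
Qed.

(** Apart from [p], the centres lie at distance sqrt 3 times [r] from [p], in directions 0 and plus
    or minus 60 degrees. Each of their discs contains a 60-degree sector of the annulus between
    radii [r] and 2[r], and three sectors fill the right half. *)
Definition spots (p : point) (r : R) : list point :=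
  let h := sqrt 3 * r in
  [p; (fst p + h, snd p); (fst p + h / 2, snd p + 3 * r / 2);
   (fst p + h / 2, snd p - 3 * r / 2)].

Lemma spots_near p r q : 0 < r -> In q (spots p r) -> dist p q <= 2 * r.
Proof.
  intros Hr Hq. apply dist_le; [lra|].
  assert (sqrt 3 * sqrt 3 = 3) as Hs by (apply sqrt_sqrt; lra).
  simpl in Hq. destruct Hq as [<-|[<-|[<-|[<-|[]]]]]; simpl; nra.
Qed.

(* With rho the distance to p, r <= rho <= 2r gives rho^2 + 2r^2 <= 3 r rho, which
   is what is needed for a centre at distance sqrt 3 r and angle at most 30 degrees. *)
Lemma spots_cover p t r : 0 < r -> fst p <= fst t -> dist t p <= 2 * r ->
  exists q, In q (spots p r) /\ dist t q <= r.
Proof.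
  intros Hr Hx Hd. apply dist_le in Hd; [|lra].
  assert (sqrt 3 * sqrt 3 = 3) as Hs by (apply sqrt_sqrt; lra).
  assert (0 < sqrt 3) as Hs0 by (apply sqrt_lt_R0; lra).
  unfold spots. set (s := sqrt 3) in *. clearbody s.
  set (u := fst t - fst p) in *. set (v := snd t - snd p) in *.

  destruct (Rle_dec (u ^ 2 + v ^ 2) (r ^ 2)) as [H1|H1].
  { exists p. split; [now left|]. apply dist_le; auto; lra. }
  set (rho := sqrt (u ^ 2 + v ^ 2)).
  assert (0 <= u ^ 2 + v ^ 2) as Hpos
    by (apply Rplus_le_le_0_compat; apply pow2_ge_0).
  assert (rho * rho = u ^ 2 + v ^ 2) as Hrho by now apply sqrt_sqrt.
  assert (0 <= rho) as Hrho0 by apply sqrt_pos. clearbody rho.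
  assert (r <= rho) as R1 by nra. assert (rho <= 2 * r) as R2 by nra.
  assert (rho * rho + 2 * r * r <= 3 * r * rho) as R3 by nra.
  assert (0 <= u) as Hu by (unfold u; lra).
  (* Since [u] is [rho] times the cosine of the polar angle, this asks whether the angle is at most
     30 degrees in absolute value. *)
  destruct (Rle_dec (s * rho) (2 * u)) as [H2|H2].
  - exists (fst p + s * r, snd p). split; [right; now left|]. apply dist_le; [lra|]. simpl.
    replace (fst t - (fst p + s * r)) with (u - s * r) by (unfold u; ring).
    fold v. assert (3 * rho <= 2 * s * u) by nra. nra.
  (* Here [v'] is the absolute value of [v], which treats the upper and the lower disc at once. [V3]
     states that the angle to the 60-degree direction is at most 30 degrees. *)
  - assert (forall v', 0 <= v' -> v' ^ 2 = v ^ 2 ->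
      (u - s * r / 2) ^ 2 + (v' - 3 * r / 2) ^ 2 <= r ^ 2) as H3.
    { intros v' Hv Ev.
      assert (rho <= 2 * v') as V1 by nra.
      assert (u <= s * v') as V2 by nra.
      assert (3 * rho <= s * u + 3 * v') as V3.
      { apply Rsqr_incr_0_var; [|nra]. unfold Rsqr.
        assert (u * u <= s * u * v') by nra. nra. }
      assert (3 * rho * r <= (s * u + 3 * v') * r) by (apply Rmult_le_compat_r; lra).
      nra. }
    destruct (Rle_dec 0 v) as [Hv|Hv].
    + exists (fst p + s * r / 2, snd p + 3 * r / 2). split; [right; right; now left|].
      apply dist_le; [lra|]. simpl fst; simpl snd.
      replace (fst t - (fst p + s * r / 2)) with (u - s * r / 2) by (unfold u; ring).
      replace (snd t - (snd p + 3 * r / 2)) with (v - 3 * r / 2) by (unfold v; ring).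
      now apply H3.
    + exists (fst p + s * r / 2, snd p - 3 * r / 2). split; [right; right; right; now left|].
      apply dist_le; [lra|]. simpl fst; simpl snd.
      replace (fst t - (fst p + s * r / 2)) with (u - s * r / 2) by (unfold u; ring).
      replace ((snd t - (snd p - 3 * r / 2)) ^ 2) with ((- v - 3 * r / 2) ^ 2) by (unfold v; ring).
      apply H3; [lra|ring].
Qed.

Definition total (b : nat -> point) (L : list (nat * point)) : R :=
  fold_right (fun s acc => dist (b (fst s)) (snd s) + acc) 0 L.

Lemma total_app b L1 L2 : total b (L1 ++ L2) = total b L1 + total b L2.
Proof. induction L1 as [|a L1 IH]; simpl; [lra|]. rewrite IH. lra. Qed.

Lemma total_nonneg b L : 0 <= total b L.
Proof. induction L as [|a L IH]; simpl; [lra|]. pose proof (dist_pos (b (fst a)) (snd a)). lra. Qed.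

(** With d the distance from the station to [p], the sensors cost d and three times at most d +
    2[r]; the sum 4d + 6[r] is below 4.6 d because [r] is below d/10. *)
Lemma spots_total b k p r : 0 < r -> dist p (b k) > 10 * r ->
  total b (map (pair k) (rev (spots p r))) <= 46 / 10 * dist p (b k).
Proof.
  intros Hr Hd.
  assert (forall q, In q (spots p r) -> dist (b k) q <= dist p (b k) + 2 * r) as H.
  { intros q Hq. pose proof (dist_triangle (b k) p q). rewrite (dist_sym (b k) p) in H.
    pose proof (spots_near p r q Hr Hq). lra. }
  unfold spots in *. simpl in *.
  pose proof (H _ (or_intror (or_introl eq_refl))).
  pose proof (H _ (or_intror (or_intror (or_introl eq_refl)))).
  pose proof (H _ (or_intror (or_intror (or_intror (or_introl eq_refl))))).
  rewrite (dist_sym (b k) p). lra.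
Qed.

(** * Lower bound from separated targets, and the greedy net *)

Section Instance.
Variable I : instance.
Hypothesis I_valid : valid_instance I.
Hypothesis I_far : far_instance I.

Definition D (j k : nat) : R := dist (tg I j) (bs I k).
Notation n := (n_tg I).
Notation m := (m_bs I).
Notation r := (radius I).

(* A sensor covers at most one of several targets at mutual distance more than 2r, so
   distinct targets are charged to distinct sensors. *)
Lemma separated_lower_bound L : forall w,
  (forall i j, (i < n)%nat -> (j < n)%nat -> w i = true -> w j = true -> i <> j ->
     dist (tg I i) (tg I j) > 2 * r) ->
  (forall s, In s L -> (fst s < m)%nat) ->
  (forall i, (i < n)%nat -> w i = true -> exists s, In s L /\ dist (tg I i) (snd s) <= r) ->
  exists op, (forall i, (i < n)%nat -> w i = true -> exists s, In s L /\ op i = fst s) /\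
    conn n w D op <= 10 / 9 * total (bs I) L.
Proof.
  induction L as [|a L IH]; intros w Hw HL Hc.
  - exists (fun _ => 0%nat). split.
    + intros i Hi Hwi. destruct (Hc i Hi Hwi) as (s & [] & _).
    + simpl. unfold conn. rewrite (sum_ext _ (fun _ => 0)), sum_0; [lra|].
      intros i Hi. destruct (w i) eqn:E; auto. destruct (Hc i Hi E) as (s & [] & _).
  - set (P := fun j => w j && (if Rle_dec (dist (tg I j) (snd a)) r then true else false)).
    destruct (find_below P n) as [(j0 & Hj0 & HP)|HP].
    + apply andb_true_iff in HP as [Hw0 HP].
      destruct (Rle_dec _ _) as [Hd|]; [|discriminate].
      set (w' := fun j => w j && negb (Nat.eqb j j0)).
      assert (forall j, w' j = true -> w j = true /\ j <> j0) as Hw'.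
      { intros j H. apply andb_true_iff in H as [H1 H2]. split; auto.
        now apply negb_true_iff, Nat.eqb_neq in H2. }
      destruct (IH w') as (op & O1 & O2).
      * intros i j Hi Hj H1 H2. apply Hw'  in H1, H2. apply Hw; tauto.
      * intros s Hs. apply HL. now right.
      * intros i Hi H1. apply Hw' in H1 as [H1 H2].
        destruct (Hc i Hi H1) as (s & [<-|Hs] & Hds); [|now exists s].
        pose proof (Hw i j0 Hi Hj0 H1 Hw0 H2).
        pose proof (dist_triangle (tg I i) (snd a) (tg I j0)) as Ht.
        rewrite (dist_sym (snd a)) in Ht. lra.
      * exists (fun j => if Nat.eqb j j0 then fst a else op j). split.
        -- intros i Hi H1. destruct (Nat.eqb_spec i j0) as [->|Hne].
           ++ exists a. split; [now left|auto].
           ++ destruct (O1 i Hi) as (s & Hs & E).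
              { unfold w'. rewrite H1. apply Nat.eqb_neq in Hne. now rewrite Hne. }
              exists s. split; [now right|auto].
        -- assert (conn n w D (fun j => if Nat.eqb j j0 then fst a else op j)
             = conn n w' D op + D j0 (fst a)) as ->.
           { pose proof (sum_single (fun j => D j (fst a)) j0 n) as H.
             apply Nat.ltb_lt in Hj0. rewrite Hj0 in H. rewrite <- H.
             unfold conn. rewrite <- sum_add. apply sum_ext. intros i _. unfold w'.
             destruct (Nat.eqb_spec i j0) as [->|]; simpl.
             - rewrite Hw0. simpl. lra.
             - rewrite andb_true_r. lra. }
           simpl. fold (total (bs I) L). unfold D at 2.
           (* The sensor stops within [r] of the target, and [r] is below a tenth of the distance to
              the station, so the sensor travels at least nine tenths of that distance. *)
           pose proof (I_far j0 (fst a) Hj0 (HL a (or_introl eq_refl))).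
           pose proof (dist_triangle (tg I j0) (snd a) (bs I (fst a))) as Ht.
           rewrite (dist_sym (snd a)) in Ht. lra.
    + destruct (IH w) as (op & O1 & O2); auto.
      * intros s Hs. apply HL. now right.
      * intros i Hi H1. destruct (Hc i Hi H1) as (s & [<-|Hs] & Hds); [|now exists s].
        specialize (HP i Hi). unfold P in HP. rewrite H1 in HP.
        destruct (Rle_dec _ _); [discriminate|lra].
      * exists op. split.
        -- intros i Hi H1. destruct (O1 i Hi H1) as (s & Hs & E). exists s.
           split; [now right|auto].
        -- simpl. fold (total (bs I) L).
           pose proof (dist_pos (bs I (fst a)) (snd a)). lra.
Qed.

Definition cnt (S : nat -> bool) (k : nat) : R := sum_upto (fun i => ind (S i) 1) k.

(** [z] is the number of rounds done, [unc] the uncovered targets, [inm] the chosen ones. The count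
    in the last clause forces [unc] to be empty after [n] rounds. *)
Definition net (z : nat) (unc inm : nat -> bool) : Prop :=
  (forall i, (i < n)%nat -> unc i = false -> exists p, (p < n)%nat /\ inm p = true /\
     dist (tg I i) (tg I p) <= 2 * r /\ fst (tg I p) <= fst (tg I i)) /\
  (forall i p, (i < n)%nat -> (p < n)%nat -> unc i = true -> inm p = true ->
     dist (tg I p) (tg I i) > 2 * r) /\
  (forall i p, (i < n)%nat -> (p < n)%nat -> inm i = true -> inm p = true -> i <> p ->
     dist (tg I i) (tg I p) > 2 * r) /\
  cnt unc n <= INR n - INR z.

Definition uncover (p : nat) (unc : nat -> bool) (i : nat) : bool :=
  if Rle_dec (dist (tg I p) (tg I i)) (2 * r) then false else unc i.
Definition insert (p : nat) (inm : nat -> bool) (i : nat) : bool :=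
  if Nat.eqb i p then true else inm i.

Lemma net_init : net 0 (fun _ => true) (fun _ => false).
Proof.
  repeat split; try discriminate. unfold cnt. simpl. rewrite sum_const. lra.
Qed.

Lemma cnt_none S k : (forall i, (i < k)%nat -> S i = false) -> cnt S k = 0.
Proof.
  intros H. unfold cnt. rewrite (sum_ext _ (fun _ => 0)); [apply sum_0|].
  intros i Hi. now rewrite H.
Qed.

Lemma net_done z unc inm : (z < n)%nat -> (forall i, (i < n)%nat -> unc i = false) ->
  net z unc inm -> net (S z) unc inm.
Proof.
  intros Hz Hu (N1 & N2 & N3 & N4). repeat split; auto.
  rewrite cnt_none by auto. apply (le_INR (S z)) in Hz. lra.
Qed.

(** The chosen [p] is itself uncovered before the round, which keeps it far from all earlier choices
    and makes the count drop, as [p] lies within 2[r] of itself. Being leftmost, it has its newly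
    covered neighbours on its right. *)
Lemma net_step z unc inm p : (p < n)%nat -> unc p = true ->
  (forall i, (i < n)%nat -> unc i = true -> fst (tg I p) <= fst (tg I i)) ->
  net z unc inm -> net (S z) (uncover p unc) (insert p inm).
Proof.
  intros Hp Hup Hx (N1 & N2 & N3 & N4). unfold net.
  assert (0 < r) as Hr by apply I_valid.
  split; [|split; [|split]].
  - intros i Hi. unfold uncover. destruct (Rle_dec _ _) as [Hd|Hd]; intros Hu.
    + destruct (unc i) eqn:Hui.
      * exists p. unfold insert. rewrite Nat.eqb_refl, (dist_sym (tg I i)). auto.
      * destruct (N1 i Hi Hui) as (p' & H1 & H2 & H3). exists p'. split; auto. split; auto.
        unfold insert. now destruct (Nat.eqb p' p).
    + destruct (N1 i Hi Hu) as (p' & H1 & H2 & H3). exists p'. split; auto. split; auto.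
      unfold insert. now destruct (Nat.eqb p' p).
  - intros i q Hi Hq. unfold uncover, insert. destruct (Rle_dec _ _) as [Hd|Hd]; [discriminate|].
    intros Hu. destruct (Nat.eqb_spec q p) as [->|]; intros H; [lra|auto].
  - intros i q Hi Hq. unfold insert.
    destruct (Nat.eqb_spec i p) as [->|], (Nat.eqb_spec q p) as [->|]; intros H1 H2 Hne; auto.
    rewrite dist_sym. now apply N2.
  - unfold cnt in *. rewrite S_INR.
    pose proof (sum_single (fun _ => 1) p n) as H. apply Nat.ltb_lt in Hp as Hp'.
    rewrite Hp' in H.
    enough (sum_upto (fun i => ind (uncover p unc i) 1) n +
      sum_upto (fun i => if Nat.eqb i p then 1 else 0) n
      <= sum_upto (fun i => ind (unc i) 1) n) by lra.
    rewrite <- sum_add. apply sum_le. intros i Hi. unfold uncover.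
    destruct (Nat.eqb_spec i p) as [->|].
    + rewrite dist_refl. destruct (Rle_dec _ _); [|lra]. rewrite Hup. simpl. lra.
    + destruct (Rle_dec _ _), (unc i); simpl; lra.
Qed.

Lemma net_covers unc inm i : net n unc inm -> (i < n)%nat ->
  exists p, (p < n)%nat /\ inm p = true /\ exists q, In q (spots (tg I p) r) /\ dist (tg I i) q <= r.
Proof.
  intros (N1 & _ & _ & N4) Hi.
  assert (unc i = false) as Hu.
  { destruct (unc i) eqn:E; auto. exfalso.
    pose proof (sum_member (fun i => ind (unc i) 1) i n) as H. simpl in H. rewrite E in H.
    unfold cnt in N4. simpl in H.
    enough (1 <= sum_upto (fun i => ind (unc i) 1) n) by lra. apply H; auto.
    intros j _. destruct (unc j); simpl; lra. }
  destruct (N1 i Hi Hu) as (p & H1 & H2 & H3 & H4). exists p. split; auto. split; auto.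
  apply spots_cover; auto. apply I_valid.
Qed.
End Instance.

(** * The algorithm *)

Notation "c1 ;; c2" := (Seq c1 c2) (at level 60, right associativity).

(* Registers. Natural: 0 = n, 1 = m, 5 = 64m, 6 = 1, 7 = 2n, 8 = 2n+2m, 9 = 0; 10-12 scratch;
   13-19 loop counters; 20 = selected index; 21 = some open station.
   Real: 0 = 0, 1 = 1, 2 = r, 3 = 2r, 4-6 = sensor offsets, 7 = 64m, 8 = 64m-1; 10 = last value,
   11 = best value, 12-16 scratch; 17 = cost of the candidate, 18 = cost bound of the current set.
   Arrays: 0 = input, 1 = uncovered targets, then all stations; 2 = net of targets;
   3 = open stations. *)
Definition setup : cmd :=
  Op (IConst 6 1) ;; Op (IConst 9 0) ;; Op (IAdd 7 0 0) ;; Op (IAdd 8 7 1) ;;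
  Op (IAdd 8 8 1) ;; Op (IAdd 10 8 1) ;; Op (OfNat 0 9) ;; Op (OfNat 1 6) ;;
  Ld 2 0 10 ;; Op (RAdd 3 2 2) ;; Op (IConst 11 3) ;; Op (OfNat 10 11) ;;
  Op (RSqrt 11 10) ;; Op (RMul 4 11 2) ;; Op (RAdd 12 1 1) ;; Op (RDiv 5 4 12) ;;
  Op (RMul 6 10 2) ;; Op (RDiv 6 6 12) ;; Op (OfNat 7 5) ;; Op (RSub 8 7 1).

Definition val_points : cmd :=
  Ld 13 0 10 ;; Op (IAdd 10 10 6) ;; Ld 14 0 10 ;;
  Ld 15 0 11 ;; Op (IAdd 11 11 6) ;; Ld 16 0 11 ;;
  Op (RSub 13 13 15) ;; Op (RSub 14 14 16) ;; Op (RMul 13 13 13) ;; Op (RMul 14 14 14) ;;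
  Op (RAdd 13 13 14) ;; Op (RSqrt 10 13).

Definition val_x (q : nat) : cmd := Op (IAdd 10 q q) ;; Ld 10 0 10.
Definition val_targets (q1 q2 : nat) : cmd :=
  Op (IAdd 10 q1 q1) ;; Op (IAdd 11 q2 q2) ;; val_points.
Definition val_dist (q : nat) : cmd :=
  Op (IAdd 10 14 14) ;; Op (IAdd 11 q q) ;; Op (IAdd 11 11 7) ;; val_points.
Definition val_open (q : nat) : cmd :=
  val_dist q ;; Op (IAdd 12 q 8) ;; Ld 16 0 12 ;; Op (RAdd 10 16 10).

(** Flags are the reals 0 and 1, so comparing the constant 1 with the loaded flag tests it. *)
Definition when (x q : nat) (c : cmd) : cmd := Ld 12 x q ;; IfR 1 12 c Skip.

(** The result is 0 if no flag is set, hence must be checked by the caller. Natural registers are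
    copied by adding register 9, which holds 0; real ones by adding real register 0. *)
Definition find_any (x N : nat) : cmd :=
  Op (IAdd 20 9 9) ;; For 15 N (when x 15 (Op (IAdd 20 15 9))).

Definition find_min (x N : nat) (val : nat -> cmd) : cmd :=
  val 20%nat ;; Op (RAdd 11 10 0) ;;
  For 15 N (when x 15 (val 15%nat ;;
    IfR 11 10 Skip (Op (RAdd 11 10 0) ;; Op (IAdd 20 15 9)))).

Definition build_net : cmd :=
  For 14 0 (St 1 14 1) ;;
  For 13 0 (find_any 1 0 ;; find_min 1 0 val_x ;;
    when 1 20 (St 2 20 1 ;; For 14 0 (val_targets 20 14 ;; IfR 10 3 (St 1 14 0) Skip))).

Definition initial : cmd :=
  For 15 1 (St 1 15 1) ;; Op (RAdd 18 0 0) ;;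
  For 14 0 (when 2 14 (Op (IAdd 20 9 9) ;; find_min 1 1 val_open ;;
    St 3 20 1 ;; Op (RAdd 18 18 11))).

Definition evaluate : cmd :=
  Op (RAdd 17 0 0) ;;
  For 15 1 (when 3 15 (Op (IAdd 12 15 8) ;; Ld 13 0 12 ;; Op (RAdd 17 17 13))) ;;
  Op (RAdd 19 0 0) ;;
  For 14 0 (when 2 14 (Op (IAdd 20 17 9) ;; find_min 3 1 val_dist ;; Op (RAdd 19 19 11))) ;;
  Op (RAdd 17 17 19).

(** Writing 0 before 1 lets opening win when the two stations coincide, as in [swap]. Both old flags
    are read before either write, so restoring them is also correct in that case. The relative
    improvement is tested by cross-multiplication. *)
Definition try_swap : cmd :=
  Ld 20 3 16 ;; Ld 21 3 17 ;; St 3 16 0 ;; St 3 17 1 ;; evaluate ;;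
  Op (RMul 22 17 7) ;; Op (RMul 23 18 8) ;;
  IfR 22 23 (Op (RAdd 18 17 0)) (St 3 17 21 ;; St 3 16 20).

Definition sweeps : cmd := For 18 0 (For 19 5 (For 16 1 (For 17 1 try_swap))).

Definition emit : cmd :=
  Op (IAdd 10 14 14) ;; Ld 24 0 10 ;; Op (IAdd 10 10 6) ;; Ld 25 0 10 ;;
  Op (OutSensor 20 24 25) ;; Op (RAdd 26 24 4) ;; Op (OutSensor 20 26 25) ;;
  Op (RAdd 26 24 5) ;; Op (RAdd 27 25 6) ;; Op (OutSensor 20 26 27) ;;
  Op (RSub 27 25 6) ;; Op (OutSensor 20 26 27).

Definition output : cmd :=
  find_any 3 1 ;; Op (IAdd 21 20 9) ;;
  For 15 1 (when 3 15 (Op (OutOpen 15))) ;;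
  For 14 0 (when 2 14 (Op (IAdd 20 21 9) ;; find_min 3 1 val_dist ;; emit)).

Definition main : cmd := setup ;; build_net ;; initial ;; sweeps ;; output.

Lemma main_wf : wf main = true.
Proof. reflexivity. Qed.

(** * Specifications of the subroutines *)

Definition b2R (b : bool) : R := if b then 1 else 0.

Definition flags (s : mem) (x : nat) (S : nat -> bool) (k : nat) : Prop :=
  forall i, (i < k)%nat -> ar s x i = b2R (S i).

(** The exempted registers are the scratch space of the searches. An objective correct at the start
    of a search thus stays correct in all its later states. *)
Definition agree (s s' : mem) : Prop :=
  (forall r, (r < 10 \/ 12 < r)%nat -> r <> 15%nat -> r <> 20%nat -> nr s' r = nr s r) /\
  (forall r, (r < 10 \/ 16 < r)%nat -> rr s' r = rr s r) /\
  (forall x, ar s' x = ar s x).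

Lemma agree_refl s : agree s s.
Proof. repeat split; auto. Qed.

Lemma agree_trans s1 s2 s3 : agree s1 s2 -> agree s2 s3 -> agree s1 s3.
Proof.
  intros (N1 & R1 & A1) (N2 & R2 & A2). split; [|split]; intros.
  - rewrite N2, N1; auto.
  - rewrite R2, R1; auto.
  - now rewrite A2, A1.
Qed.

Ltac ev := cbn [den wrN wrR wrA nr rr ar oo os updN updR Nat.eqb].

Lemma den_seq c1 c2 s : den (c1 ;; c2) s = den c2 (den c1 s).
Proof. reflexivity. Qed.

Lemma os_wrN s i v : os (wrN s i v) = os s.
Proof. reflexivity. Qed.

(* Naming the intermediate states keeps the terms linear in the length of the code. *)
Ltac name_states :=
  repeat match goal with |- context [den (?c1 ;; ?c2) ?s] =>
    rewrite (den_seq c1 c2 s);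
    let t := fresh "t" in let E := fresh "Et" in remember (den c1 s) as t eqn:E end.
Ltac seqs :=
  repeat match goal with |- context [den (?c1 ;; ?c2) ?s] =>
    rewrite (den_seq c1 c2 s) end.
Ltac unwind := ev; repeat match goal with
  E : ?t = den _ _ |- context [?t] => rewrite E; clear E; ev end.

Lemma agree_Ld s d x i : (10 <= d <= 16)%nat -> agree s (den (Ld d x i) s).
Proof.
  intros Hd. repeat split; intros; ev; auto. rewrite updR_neq; auto. lia.
Qed.

Lemma when_den x q c s b : rr s 1 = 1 -> ar s x (nr s q) = b2R b ->
  den (when x q c) s = if b then den c (den (Ld 12 x q) s) else den (Ld 12 x q) s.
Proof.
  intros H1 Hb. unfold when. cbn [den]. ev. rewrite H1, Hb.
  destruct b; simpl; destruct (Rle_dec _ _); auto; lra.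
Qed.

Section Instance.
Variable I : instance.
Notation n := (n_tg I).
Notation m := (m_bs I).
Notation r := (radius I).

Definition Env (s : mem) : Prop :=
  (nr s 0 = n /\ nr s 1 = m /\ nr s 5 = (64 * m)%nat /\ nr s 6 = 1%nat /\
   nr s 7 = (n + n)%nat /\ nr s 8 = (n + n + m + m)%nat /\ nr s 9 = 0%nat) /\
  (rr s 0 = 0 /\ rr s 1 = 1 /\ rr s 2 = r /\ rr s 3 = 2 * r /\
   rr s 4 = sqrt 3 * r /\ rr s 5 = sqrt 3 * r / 2 /\ rr s 6 = 3 * r / 2 /\
   rr s 7 = 64 * INR m /\ rr s 8 = 64 * INR m - 1) /\
  (forall j, ar s 0 j = input_rm I j).

(** A syntactic test for preserving [Env], discharged by computation for each concrete command. *)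
Definition keeps (c : cmd) : bool :=
  forallb (fun x => negb (nwr c x)) [0; 1; 5; 6; 7; 8; 9]%nat &&
  forallb (fun x => negb (rwr c x)) [0; 1; 2; 3; 4; 5; 6; 7; 8]%nat &&
  negb (awr c 0).

Lemma Env_same c s s' : same c s s' -> Env s -> keeps c = true -> Env s'.
Proof.
  intros (N & R & A & _) (E1 & E2 & E3) K. unfold keeps in K. cbn [forallb] in K.
  rewrite !andb_true_iff, !negb_true_iff in K.
  unfold Env. rewrite !N, !R, A by tauto. auto.
Qed.

Lemma Env_den c s : keeps c = true -> Env s -> Env (den c s).
Proof. intros K E. exact (Env_same c s _ (den_same c s) E K). Qed.

Lemma Env_agree s s' : agree s s' -> Env s -> Env s'.
Proof.
  intros (N & R & A) (E1 & E2 & E3). unfold Env.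
  rewrite !N, !R, A by lia. auto.
Qed.

Lemma Env_count s i v : (9 < i)%nat -> Env s -> Env (wrN s i v).
Proof.
  intros Hi H. unfold Env. cbn [wrN nr rr ar]. rewrite !updN_neq by lia. exact H.
Qed.

Lemma even_twice i : Nat.even (i + i) = true /\ Nat.div2 (i + i) = i.
Proof.
  replace (i + i)%nat with (2 * i)%nat by lia. split.
  - rewrite Nat.even_mul. reflexivity.
  - apply Nat.div2_double.
Qed.

Lemma odd_twice i : Nat.even (i + i + 1) = false /\ Nat.div2 (i + i + 1) = i.
Proof.
  replace (i + i + 1)%nat with (S (2 * i)) by lia. split.
  - rewrite Nat.even_succ, <- Nat.negb_even, Nat.even_mul. reflexivity.
  - apply Nat.div2_succ_double.
Qed.

Ltac ltb_true := rewrite (proj2 (Nat.ltb_lt _ _)) by lia.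
Ltac ltb_false := rewrite (proj2 (Nat.ltb_ge _ _)) by lia.

Lemma input_tx i : (i < n)%nat -> input_rm I (i + i) = fst (tg I i).
Proof.
  intros Hi. unfold input_rm. ltb_true. destruct (even_twice i) as [-> ->]. reflexivity.
Qed.
Lemma input_ty i : (i < n)%nat -> input_rm I (i + i + 1) = snd (tg I i).
Proof.
  intros Hi. unfold input_rm. ltb_true. destruct (odd_twice i) as [-> ->]. reflexivity.
Qed.
Lemma input_bx k : (k < m)%nat -> input_rm I (k + k + (n + n)) = fst (bs I k).
Proof.
  intros Hk. unfold input_rm. ltb_false. ltb_true.
  replace (k + k + (n + n) - 2 * n)%nat with (k + k)%nat by lia.
  destruct (even_twice k) as [-> ->]. reflexivity.
Qed.
Lemma input_by k : (k < m)%nat -> input_rm I (k + k + (n + n) + 1) = snd (bs I k).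
Proof.
  intros Hk. unfold input_rm. ltb_false. ltb_true.
  replace (k + k + (n + n) + 1 - 2 * n)%nat with (k + k + 1)%nat by lia.
  destruct (odd_twice k) as [-> ->]. reflexivity.
Qed.
Lemma input_cost k : (k < m)%nat -> input_rm I (k + (n + n + m + m)) = ocost I k.
Proof.
  intros Hk. unfold input_rm. ltb_false. ltb_false. ltb_true. f_equal. lia.
Qed.
Lemma input_radius : input_rm I (n + n + m + m + m) = r.
Proof.
  unfold input_rm. ltb_false. ltb_false. ltb_false.
  now replace (n + n + m + m + m =? 2 * n + 3 * m)%nat with true
    by (symmetry; apply Nat.eqb_eq; lia).
Qed.

Lemma dist_mul p q : sqrt ((fst p - fst q) * (fst p - fst q) + (snd p - snd q) * (snd p - snd q))
  = dist p q.
Proof. unfold dist. f_equal. ring. Qed.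

Lemma val_points_spec s p q : Env s ->
  input_rm I (nr s 10) = fst p -> input_rm I (nr s 10 + 1) = snd p ->
  input_rm I (nr s 11) = fst q -> input_rm I (nr s 11 + 1) = snd q ->
  rr (den val_points s) 10 = dist p q.
Proof.
  intros (E1 & E2 & E3) H1 H2 H3 H4. unfold val_points. name_states. unwind.
  destruct E1 as (_ & _ & _ & -> & _). rewrite !E3, H1, H2, H3, H4. apply dist_mul.
Qed.

Lemma val_dist_spec s q : Env s -> q = 15%nat \/ q = 20%nat ->
  (nr s 14 < n)%nat -> (nr s q < m)%nat ->
  rr (den (val_dist q) s) 10 = D I (nr s 14) (nr s q).
Proof.
  intros E Hq H14 Hk. unfold val_dist. seqs. apply val_points_spec.
  - do 3 (apply Env_count; [lia|]). exact E.
  - ev. now apply input_tx.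
  - ev. now apply input_ty.
  - destruct E as ((_ & _ & _ & _ & E7 & _) & _). destruct Hq as [->| ->]; ev; rewrite E7; now apply input_bx.
  - destruct E as ((_ & _ & _ & _ & E7 & _) & _). destruct Hq as [->| ->]; ev; rewrite E7; now apply input_by.
Qed.

Lemma val_targets_spec s : Env s -> (nr s 20 < n)%nat -> (nr s 14 < n)%nat ->
  rr (den (val_targets 20 14) s) 10 = dist (tg I (nr s 20)) (tg I (nr s 14)).
Proof.
  intros E Hq H14. unfold val_targets. seqs. apply val_points_spec.
  - do 2 (apply Env_count; [lia|]). exact E.
  - ev. now apply input_tx.
  - ev. now apply input_ty.
  - ev. now apply input_tx.
  - ev. now apply input_ty.
Qed.

Lemma val_x_spec s q : Env s -> q = 15%nat \/ q = 20%nat ->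
  (nr s q < n)%nat -> rr (den (val_x q) s) 10 = fst (tg I (nr s q)).
Proof.
  intros (E1 & E2 & E3) Hq Hk. unfold val_x. destruct Hq as [->| ->]; ev; rewrite E3; now apply input_tx.
Qed.

Lemma val_open_spec s q : Env s -> q = 15%nat \/ q = 20%nat ->
  (nr s 14 < n)%nat -> (nr s q < m)%nat ->
  rr (den (val_open q) s) 10 = ocost I (nr s q) + D I (nr s 14) (nr s q).
Proof.
  intros E Hq H14 Hk. unfold val_open. seqs.
  pose proof (val_dist_spec s q E Hq H14 Hk) as HD.
  assert (Env (den (val_dist q) s)) as ((_ & _ & _ & _ & _ & E8 & _) & _ & E3).
  { apply Env_den; [reflexivity|exact E]. }
  destruct (den_same (val_dist q) s) as (N & _).
  assert (nr (den (val_dist q) s) q = nr s q) as Nq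
    by (apply N; destruct Hq as [->| ->]; reflexivity).
  assert (forall t, nr t q = nr s q -> nr t 8 = (n + n + m + m)%nat ->
    (forall j, ar t 0 j = input_rm I j) -> rr (den (Op (RAdd 10 16 10))
    (den (Ld 16 0 12) (den (Op (IAdd 12 q 8)) t))) 10 = ocost I (nr s q) + rr t 10) as H.
  { intros t T1 T2 T3. ev. rewrite T1, T2, T3. f_equal. now apply input_cost. }
  rewrite <- HD. now apply H.
Qed.

(* What find_min needs from the command computing the objective [f]. *)
Definition val_ok (s : mem) (val : nat -> cmd) (f : nat -> R) (N : nat) : Prop :=
  forall s' q, agree s s' -> q = 15%nat \/ q = 20%nat -> (nr s' q < N)%nat ->
  let t := den (val q) s' in
  agree s' t /\ nr t 15 = nr s' 15 /\ nr t 20 = nr s' 20 /\ rr t 11 = rr s' 11 /\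
  rr t 10 = f (nr s' q).

Lemma agree_den c s :
  (forall x, (x < 10 \/ 12 < x)%nat -> x <> 15%nat -> x <> 20%nat -> nwr c x = false) ->
  (forall x, (x < 10 \/ 16 < x)%nat -> rwr c x = false) ->
  (forall x, awr c x = false) -> agree s (den c s).
Proof.
  intros HN HR HA. destruct (den_same c s) as (N & R & A & _).
  split; [|split]; auto.
Qed.

Ltac solve_frame := intros; simpl; rewrite ?orb_false_iff, ?Nat.eqb_neq; repeat split; lia.

Lemma val_x_ok s : Env s -> val_ok s val_x (fun k => fst (tg I k)) n.
Proof.
  intros E s' q Ha Hq Hk t.
  assert (same (val_x q) s' t) as (N & R & _) by apply den_same.
  split; [apply agree_den; try solve_frame; auto|].
  do 2 (split; [now apply N|]). split; [now apply R|].
  apply val_x_spec; auto. now apply (Env_agree s).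
Qed.

Lemma val_dist_ok s : Env s -> (nr s 14 < n)%nat -> val_ok s val_dist (D I (nr s 14)) m.
Proof.
  intros E H14 s' q Ha Hq Hk t.
  assert (same (val_dist q) s' t) as (N & R & _) by apply den_same.
  split; [apply agree_den; try solve_frame; auto|].
  do 2 (split; [now apply N|]). split; [now apply R|].
  assert (nr s' 14 = nr s 14) as H by (apply Ha; lia).
  rewrite <- H. apply val_dist_spec; auto; [now apply (Env_agree s)|lia].
Qed.

Lemma val_open_ok s : Env s -> (nr s 14 < n)%nat ->
  val_ok s val_open (fun k => ocost I k + D I (nr s 14) k) m.
Proof.
  intros E H14 s' q Ha Hq Hk t.
  assert (same (val_open q) s' t) as (N & R & _) by apply den_same.
  split; [apply agree_den; try solve_frame; auto|].
  do 2 (split; [now apply N|]). split; [now apply R|].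
  assert (nr s' 14 = nr s 14) as H by (apply Ha; lia).
  rewrite <- H. apply val_open_spec; auto; [now apply (Env_agree s)|lia].
Qed.

Lemma agree_count s s' i v : (10 <= i <= 12)%nat \/ i = 15%nat \/ i = 20%nat ->
  agree s s' -> agree s (wrN s' i v).
Proof.
  intros Hi (N & R & A). split; [|split]; auto.
  intros x H1 H2 H3. cbn [wrN nr]. rewrite updN_neq by lia. auto.
Qed.

Lemma agree_real s s' i v : (10 <= i <= 16)%nat -> agree s s' -> agree s (wrR s' i v).
Proof.
  intros Hi (N & R & A). split; [|split]; auto.
  intros x H1. cbn [wrR rr]. rewrite updR_neq by lia. auto.
Qed.

Lemma find_any_spec s x Nr N S : Env s -> nr s Nr = N -> (Nr < 10)%nat -> flags s x S N ->
  let t := den (find_any x Nr) s in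
  agree s t /\ ((nr t 20 < N)%nat \/ nr t 20 = 0%nat) /\
  ((exists i, (i < N)%nat /\ S i = true) -> (nr t 20 < N)%nat /\ S (nr t 20) = true).
Proof.
  intros E HN HNr HS. unfold find_any. cbn [den].
  set (s0 := wrN s 20 _).
  assert (nr s0 Nr = N) as HN0 by (unfold s0; cbn [wrN nr]; rewrite updN_neq; auto; lia).
  assert (agree s s0) as A0 by (apply agree_count; auto using agree_refl).
  assert (nr s0 20 = 0%nat) as H20.
  { unfold s0. ev. destruct E as ((_ & _ & _ & _ & _ & _ & ->) & _). reflexivity. }
  pose proof (for_rule (fun k t => agree s t /\ ((nr t 20 < N)%nat \/ nr t 20 = 0%nat) /\
    ((exists i, (i < k)%nat /\ S i = true) -> (nr t 20 < N)%nat /\ S (nr t 20) = true))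
    15 Nr (when x 15 (Op (IAdd 20 15 9))) s0) as H.
  rewrite HN0 in H. apply H; clear H.
  - split; [apply agree_count; auto|]. split; [right; exact H20|]. intros (i & Hi & _). lia.
  - intros k t Hk Hsame Ht (B1 & B2 & B3).
    assert (Env t) as Et by now apply (Env_agree s).
    rewrite (when_den x 15 _ t (S k)).
    2:{ apply Et. } 2:{ destruct B1 as (_ & _ & ->). rewrite Ht. auto. }
    destruct (S k) eqn:HSk.
    + assert (nr t 15 + nr t 9 = k)%nat as Hv.
      { rewrite Ht. destruct Et as ((_ & _ & _ & _ & _ & _ & ->) & _). lia. }
      split.
      { apply agree_count; auto. cbn [den]. apply agree_count; auto.
        apply (agree_trans s t); auto. apply agree_Ld. lia. }
      ev. rewrite Hv. split; [now left|]. intros _. auto.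
    + split; [apply agree_count; auto; apply (agree_trans s t); auto; apply agree_Ld; lia|].
      ev. split; auto. intros (i & Hi & HSi). apply B3. exists i. split; auto.
      destruct (Nat.eq_dec i k) as [->|]; [congruence|lia].
Qed.

Lemma find_min_spec s x Nr N S f val : Env s -> nr s Nr = N -> (Nr < 10)%nat -> flags s x S N ->
  (nr s 20 < N)%nat -> val_ok s val f N ->
  let t := den (find_min x Nr val) s in
  agree s t /\ nr t 20 = argmin S f (nr s 20) N /\ rr t 11 = f (argmin S f (nr s 20) N).
Proof.
  intros E HN HNr HS Hd HV. unfold find_min. cbn [den].
  destruct (HV s 20%nat (agree_refl s) (or_intror eq_refl) Hd) as (V1 & V2 & V3 & V4 & V5).
  set (s1 := den (val 20%nat) s) in *.
  set (s0 := wrR s1 11 _).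
  assert (agree s s0) as A0 by (apply agree_real; auto; lia).
  assert (nr s0 Nr = N) as HN0.
  { destruct A0 as (A0 & _). rewrite A0; auto; lia. }
  assert (rr s0 11 = f (nr s 20)) as H11.
  { unfold s0. ev. rewrite V5. assert (Env s1) as E1 by now apply (Env_agree s).
    destruct E1 as (_ & (-> & _) & _). lra. }
  set (d := nr s 20) in *. clearbody s1.
  pose proof (for_rule (fun k t => agree s t /\ nr t 20 = argmin S f d k /\
    rr t 11 = f (argmin S f d k)) 15 Nr
    (when x 15 (val 15%nat ;; IfR 11 10 Skip (Op (RAdd 11 10 0) ;; Op (IAdd 20 15 9)))) s0) as H.
  rewrite HN0 in H. apply H; clear H.
  - split; [apply agree_count; auto|]. split; [exact V3|exact H11].
  - intros k t Hk Hsame Ht (B1 & B2 & B3).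
    assert (Env t) as Et by now apply (Env_agree s).
    rewrite (when_den x 15 _ t (S k)).
    2:{ apply Et. } 2:{ destruct B1 as (_ & _ & ->). rewrite Ht. auto. }
    assert (agree s (den (Ld 12 x 15) t)) as B1'.
    { apply (agree_trans s t); auto. apply agree_Ld. lia. }
    cbn [argmin]. destruct (S k) eqn:HSk.
    + set (t1 := den (Ld 12 x 15) t) in *.
      assert (nr t1 15 = k) as Ht1 by exact Ht.
      destruct (HV t1 15%nat B1' (or_introl eq_refl)) as (W1 & W2 & W3 & W4 & W5); [lia|].
      assert (nr t1 20 = argmin S f d k) as B2' by exact B2.
      assert (rr t1 11 = f (argmin S f d k)) as B3' by exact B3.
      clearbody t1. cbn [den]. set (t2 := den (val 15%nat) t1) in *. clearbody t2.
      assert (agree s t2) as C1 by now apply (agree_trans s t1).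
      rewrite W4, W5, B3', Ht1. destruct (Rle_dec _ _) as [Hle|Hle].
      * split; [apply agree_count; auto|]. ev. now rewrite W3, W4, B2', B3'.
      * split.
        { apply agree_count; auto. apply agree_count; auto. apply agree_real; auto; lia. }
        assert (Env t2) as E2 by now apply (Env_agree s).
        destruct E2 as ((_ & _ & _ & _ & _ & _ & E9) & (E0 & _) & _).
        ev. rewrite W2, E9, E0, Ht1. split; [lia|lra].
    + split; [apply agree_count; auto|]. split; [exact B2|exact B3].
Qed.

Lemma flags_ar s t x S k : ar t x = ar s x -> flags s x S k -> flags t x S k.
Proof. intros H F i Hi. rewrite H. auto. Qed.

Lemma fill_spec s i Nr x : rr s 1 = 1 ->
  flags (den (For i Nr (St x i 1)) s) x (fun _ => true) (nr s Nr).
Proof.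
  intros H1.
  apply (for_rule (fun k t => flags t x (fun _ => true) k)); [intros j Hj; lia|].
  intros k t Hk (_ & R & _) Ht F j Hj. ev. rewrite Nat.eqb_refl, Ht, (R 1%nat eq_refl).
  unfold updR. destruct (Nat.eqb_spec j k); [exact H1|]. apply F. lia.
Qed.

Lemma setup_spec s : nr s 0 = n -> nr s 1 = m -> nr s 5 = (64 * m)%nat ->
  (forall j, ar s 0 j = input_rm I j) -> Env (den setup s).
Proof.
  intros H0 H1 H5 HI. unfold Env.
  assert (INR 0 = 0) as R0 by reflexivity. assert (INR 1 = 1) as R1 by reflexivity.
  assert (INR 3 = 3) as R3 by (simpl; lra).
  assert (INR (64 * m) = 64 * INR m) as RQ.
  { rewrite mult_INR. replace (INR 64) with 64 by (simpl; lra). reflexivity. }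
  unfold setup. name_states.
  split; [repeat split; unwind; lia|].
  split; [repeat split; unwind;
    rewrite ?H0, ?H1, ?H5, ?HI, ?input_radius, ?R0, ?R1, ?R3, ?RQ; try lra|].
  intros j. unwind. apply HI.
Qed.

Hypothesis I_valid : valid_instance I.

Lemma uncover_spec s unc : Env s -> (nr s 20 < n)%nat -> flags s 1 unc n ->
  flags (den (For 14 0 (val_targets 20 14 ;; IfR 10 3 (St 1 14 0) Skip)) s) 1
    (uncover I (nr s 20) unc) n.
Proof.
  intros E Hp F. set (c := For _ _ _).
  pose proof (for_rule (fun k t => forall i, (i < n)%nat -> ar t 1 i =
    b2R (if Nat.ltb i k then uncover I (nr s 20) unc i else unc i)) 14 0
    (val_targets 20 14 ;; IfR 10 3 (St 1 14 0) Skip) s) as H.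
  assert (nr s 0 = n) as En by apply E. rewrite En in H.
  assert (forall i, (i < n)%nat -> ar (den c s) 1 i =
    b2R (if Nat.ltb i n then uncover I (nr s 20) unc i else unc i)) as H1.
  2:{ intros i Hi. rewrite H1 by auto. now rewrite (proj2 (Nat.ltb_lt _ _) Hi). }
  apply H; clear H; [exact F|].
  intros k t Hk Hs Ht Inv i Hi.
  assert (Env t) as Et by exact (Env_same _ _ _ Hs E eq_refl).
  assert (nr t 20 = nr s 20) as E20 by now apply Hs.
  pose proof (val_targets_spec t Et ltac:(lia) ltac:(lia)) as HV.
  destruct (den_same (val_targets 20 14) t) as (N & R & A & _).
  pose proof (A 1%nat eq_refl) as A1. pose proof (N 14%nat eq_refl) as N14.
  pose proof (R 3%nat eq_refl) as R3. pose proof (R 0%nat eq_refl) as R0.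
  destruct Et as (_ & (E0 & _ & _ & E3 & _) & _).
  rewrite E20, Ht in HV. rewrite Ht in N14. rewrite E3 in R3. rewrite E0 in R0.
  seqs. set (t1 := den (val_targets 20 14) t) in *. clearbody t1.
  cbn [den]. rewrite HV, R3.
  assert (forall P Q : bool, (if (i <? S k)%nat then P else Q) =
    if Nat.eqb i k then P else if (i <? k)%nat then P else Q) as HS.
  { intros P Q. destruct (Nat.ltb_spec i (S k)), (Nat.eqb_spec i k), (Nat.ltb_spec i k);
      auto; lia. }
  rewrite HS. unfold uncover at 1.
  destruct (Rle_dec (dist (tg I (nr s 20)) (tg I k)) (2 * r)) as [Hd|Hd]; ev;
    rewrite ?N14, ?R0, ?A1; destruct (Nat.eqb_spec i k) as [->|Hne].
  - unfold updR. rewrite Nat.eqb_refl. destruct (Rle_dec _ _); [reflexivity|contradiction].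
  - unfold updR. apply Nat.eqb_neq in Hne. rewrite Hne. auto.
  - destruct (Rle_dec _ _); [contradiction|]. rewrite Inv by auto.
    now rewrite Nat.ltb_irrefl.
  - auto.
Qed.

Definition round : cmd :=
  find_any 1 0 ;; find_min 1 0 val_x ;;
  when 1 20 (St 2 20 1 ;; For 14 0 (val_targets 20 14 ;; IfR 10 3 (St 1 14 0) Skip)).

Lemma round_spec s z unc inm : Env s -> (z < n)%nat ->
  flags s 1 unc n -> flags s 2 inm n -> net I z unc inm ->
  exists unc' inm', flags (den round s) 1 unc' n /\ flags (den round s) 2 inm' n /\
    net I (S z) unc' inm'.
Proof.
  intros E Hz F1 F2 HN. unfold round. seqs.
  assert (nr s 0 = n) as En by apply E.
  destruct (find_any_spec s 1 0 n unc E En ltac:(lia) F1) as (A1 & P1 & P2).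
  set (s1 := den (find_any 1 0) s) in *. clearbody s1.
  assert (Env s1) as E1 by now apply (Env_agree s).
  assert (nr s1 0 = n) as En1 by apply E1.
  assert (flags s1 1 unc n) as F1' by (apply (flags_ar s); auto; apply A1).
  assert (flags s1 2 inm n) as F2' by (apply (flags_ar s); auto; apply A1).
  destruct (find_min_spec s1 1 0 n unc _ _ E1 En1 ltac:(lia) F1' ltac:(lia) (val_x_ok s1 E1))
    as (A2 & P3 & _).
  set (f := fun k => fst (tg I k)) in *. set (d := nr s1 20) in *.
  set (s2 := den (find_min 1 0 val_x) s1) in *. clearbody s2.
  assert (Env s2) as E2 by now apply (Env_agree s1).
  assert (flags s2 1 unc n) as F1'' by (apply (flags_ar s1); auto; apply A2).
  assert (flags s2 2 inm n) as F2'' by (apply (flags_ar s1); auto; apply A2).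
  set (p := argmin unc f d n) in *.
  assert (p < n)%nat as Hp by (apply argmin_lt; lia).
  rewrite (when_den 1 20 _ s2 (unc p)); [|apply E2|rewrite P3; auto].
  destruct (unc p) eqn:Hu.
  - exists (uncover I p unc), (insert p inm).
    assert (Env (den (Ld 12 1 20) s2)) as E3 by (apply Env_den; auto).
    set (s3 := den (Ld 12 1 20) s2) in *.
    assert (flags s3 1 unc n) as G1 by exact F1''.
    assert (flags s3 2 inm n) as G2 by exact F2''.
    assert (nr s3 20 = p) as G3 by exact P3. clearbody s3. seqs.
    assert (Env (den (St 2 20 1) s3)) as E4 by (apply Env_den; auto).
    set (s4 := den (St 2 20 1) s3) in *.
    assert (flags s4 1 unc n) as K1 by exact G1.
    assert (nr s4 20 = p) as K3 by exact G3.
    assert (flags s4 2 (insert p inm) n) as K2.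
    { intros i Hi. unfold s4, insert. ev. rewrite G3. unfold updR.
      destruct (Nat.eqb i p); [apply E3|auto]. }
    clearbody s4. rewrite <- K3 at 1. split; [|split].
    + apply uncover_spec; auto. lia.
    + apply (flags_ar s4); auto. now apply den_same.
    + apply net_step; auto. intros i Hi Hui.
      now apply (argmin_le unc f d n i).
  (* A search started at an uncovered target stays among uncovered ones, so ending at a covered
     target means that none was left and the round is idle. *)
  - exists unc, inm. split; [exact F1''|]. split; [exact F2''|].
    apply net_done; auto. intros i Hi. destruct (unc i) eqn:Hui; auto.
    destruct (P2 (ex_intro _ i (conj Hi Hui))) as [Hd1 Hd2].
    destruct (argmin_mem unc f d n n Hd1 Hd2 (Nat.le_refl n)) as [_ H]. fold p in H. congruence.
Qed.

Lemma build_net_spec s : Env s -> (forall j, ar s 2 j = 0) ->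
  exists unc inm, flags (den build_net s) 2 inm n /\ net I n unc inm.
Proof.
  intros E H2. unfold build_net. seqs.
  pose proof (fill_spec s 14 0 1 ltac:(apply E)) as F.
  assert (Env (den (For 14 0 (St 1 14 1)) s)) as E1 by (apply Env_den; auto).
  assert (ar (den (For 14 0 (St 1 14 1)) s) 2 = ar s 2) as A2 by now apply den_same.
  replace (nr s 0) with n in F by (symmetry; apply E).
  set (s1 := den (For 14 0 (St 1 14 1)) s) in *. clearbody s1.
  pose proof (for_rule (fun k t => exists unc inm, flags t 1 unc n /\ flags t 2 inm n /\
    net I k unc inm) 13 0 round s1) as H.
  assert (nr s1 0 = n) as En by apply E1. rewrite En in H.
  destruct H as (unc & inm & _ & G2 & G3).
  - exists (fun _ => true), (fun _ => false). split; [exact F|]. split.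
    + intros i Hi. ev. rewrite A2. apply H2.
    + apply net_init; auto.
  - intros k t Hk Hs Ht (unc & inm & G1 & G2 & G3).
    apply (round_spec t k unc inm); auto. exact (Env_same _ _ _ Hs E1 eq_refl).
  - exists unc, inm. split; [exact G2|exact G3].
Qed.

Variable w : nat -> bool.
Notation f := (ocost I).
Notation Dt := (D I).
Notation Q := (64 * INR m).
Hypothesis m_pos : (0 < m)%nat.

Definition open_step : cmd :=
  Op (IAdd 20 9 9) ;; find_min 1 1 val_open ;; St 3 20 1 ;; Op (RAdd 18 18 11).

Lemma initial_spec s : Env s -> flags s 2 w n -> (forall j, ar s 3 j = 0) ->
  flags (den initial s) 3 (init_set m w f Dt n) m /\
  rr (den initial s) 18 = init_cost m w f Dt n.
Proof.
  intros E F2 H3. unfold initial. seqs.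
  pose proof (fill_spec s 15 1 1 ltac:(apply E)) as F.
  assert (Env (den (For 15 1 (St 1 15 1)) s)) as E1 by (apply Env_den; auto).
  destruct (den_same (For 15 1 (St 1 15 1)) s) as (_ & _ & A & _).
  pose proof (A 2%nat eq_refl) as A2. pose proof (A 3%nat eq_refl) as A3.
  replace (nr s 1) with m in F by (symmetry; apply E).
  set (s1 := den (For 15 1 (St 1 15 1)) s) in *. clearbody s1.
  assert (Env (den (Op (RAdd 18 0 0)) s1)) as E2 by (apply Env_den; auto).
  set (s2 := den (Op (RAdd 18 0 0)) s1) in *.
  assert (flags s2 1 (fun _ => true) m) as F' by exact F.
  assert (ar s2 2 = ar s 2) as A2' by exact A2.
  assert (ar s2 3 = ar s 3) as A3' by exact A3.
  assert (rr s2 18 = 0) as R18.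
  { unfold s2. ev. destruct E1 as (_ & (-> & _) & _). lra. }
  clearbody s2. clear A.
  pose proof (for_rule (fun k t => flags t 3 (init_set m w f Dt k) m /\
    rr t 18 = init_cost m w f Dt k) 14 0 (when 2 14 open_step) s2) as H.
  assert (nr s2 0 = n) as En by apply E2. rewrite En in H.
  apply H; clear H.
  { split; [|exact R18]. intros i Hi. ev. rewrite A3'. apply H3. }
  intros k t Hk Hs Ht (G1 & G2).
  assert (Env t) as Et by exact (Env_same _ _ _ Hs E2 eq_refl).
  destruct Hs as (_ & _ & A & _).
  pose proof (A 1%nat eq_refl) as B1. pose proof (A 2%nat eq_refl) as B2. clear A.
  rewrite (when_den 2 14 _ t (w k)); [|apply Et|rewrite B2, A2', Ht; auto].
  unfold init_set, init_cost. cbn [floop sum_upto].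
  fold (init_set m w f Dt k). fold (init_cost m w f Dt k).
  destruct (w k) eqn:Hw; cbn [ind].
  2:{ split; [exact G1|]. ev. rewrite G2. lra. }
  assert (Env (den (Ld 12 2 14) t)) as E3 by (apply Env_den; auto).
  set (t1 := den (Ld 12 2 14) t) in *.
  assert (flags t1 1 (fun _ => true) m) as K1 by (intros i Hi; change (ar t 1 i = 1); rewrite B1; now apply F').
  assert (flags t1 3 (init_set m w f Dt k) m) as K3 by exact G1.
  assert (rr t1 18 = init_cost m w f Dt k) as K4 by exact G2.
  assert (nr t1 14 = k) as K5 by exact Ht. clearbody t1.
  unfold open_step. seqs.
  assert (Env (den (Op (IAdd 20 9 9)) t1)) as E4 by (apply Env_den; auto).
  set (t2 := den (Op (IAdd 20 9 9)) t1) in *.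
  assert (flags t2 1 (fun _ => true) m) as L1 by exact K1.
  assert (flags t2 3 (init_set m w f Dt k) m) as L3 by exact K3.
  assert (rr t2 18 = init_cost m w f Dt k) as L4 by exact K4.
  assert (nr t2 14 = k) as L5 by exact K5.
  assert (nr t2 20 = 0%nat) as L6.
  { unfold t2. ev. destruct E3 as ((_ & _ & _ & _ & _ & _ & ->) & _). reflexivity. }
  clearbody t2.
  assert (nr t2 1 = m) as Em by apply E4.
  destruct (find_min_spec t2 1 1 m _ _ val_open E4 Em ltac:(lia) L1 ltac:(lia)
    (val_open_ok t2 E4 ltac:(lia))) as ((N1 & R1 & A1) & P1 & P2).
  assert (Env (den (find_min 1 1 val_open) t2)) as E5 by (apply Env_den; auto).
  set (t3 := den (find_min 1 1 val_open) t2) in *. clearbody t3.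
  rewrite L5, L6 in P1, P2. fold (favourite m f Dt k) in P1, P2.
  split.
  - intros i Hi. ev. rewrite P1, A1. unfold swap. unfold updR.
    destruct (Nat.eqb i (favourite m f Dt k)); [apply E5|auto].
  - ev. rewrite P2, R1, L4 by lia. reflexivity.
Qed.

Lemma evaluate_spec s T : Env s -> flags s 2 w n -> flags s 3 T m -> (nr s 17 < m)%nat ->
  rr (den evaluate s) 17 = Phi n m w f Dt T (nr s 17).
Proof.
  intros E F2 F3 Ho. set (o := nr s 17) in *. unfold evaluate. seqs.
  assert (Env (den (Op (RAdd 17 0 0)) s)) as E1 by (apply Env_den; auto).
  set (s1 := den (Op (RAdd 17 0 0)) s) in *.
  assert (flags s1 2 w n) as G2 by exact F2.
  assert (flags s1 3 T m) as G3 by exact F3.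
  assert (nr s1 17 = o) as G4 by reflexivity.
  assert (rr s1 17 = 0) as G5.
  { unfold s1. ev. destruct E as (_ & (-> & _) & _). lra. }
  clearbody s1.
  set (c1 := For 15 1 _).
  assert (rr (den c1 s1) 17 = fcost m f T) as H1.
  { pose proof (for_rule (fun k t => rr t 17 = fcost k f T) 15 1
      (when 3 15 (Op (IAdd 12 15 8) ;; Ld 13 0 12 ;; Op (RAdd 17 17 13))) s1) as H.
    assert (nr s1 1 = m) as Em by apply E1. rewrite Em in H.
    apply H; clear H; [exact G5|].
    intros k t Hk Hs Ht Inv.
    assert (Env t) as Et by exact (Env_same _ _ _ Hs E1 eq_refl).
    destruct Hs as (_ & _ & A & _). pose proof (A 3%nat eq_refl) as A3.
    rewrite (when_den 3 15 _ t (T k)); [|apply Et|rewrite A3, Ht; auto].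
    unfold fcost. cbn [sum_upto]. fold (fcost k f T). destruct (T k).
    - ev. rewrite Inv, Ht. destruct Et as ((_ & _ & _ & _ & _ & -> & _) & _ & ->).
      now rewrite input_cost.
    - ev. rewrite Inv. lra. }
  assert (Env (den c1 s1)) as E2 by (apply Env_den; auto).
  destruct (den_same c1 s1) as (N & _ & A & _).
  assert (flags (den c1 s1) 2 w n) as K2 by (apply (flags_ar s1); auto).
  assert (flags (den c1 s1) 3 T m) as K3 by (apply (flags_ar s1); auto).
  assert (nr (den c1 s1) 17 = o) as K4 by (rewrite N; auto).
  set (s2 := den c1 s1) in *. clearbody s2. clear N A c1.
  assert (Env (den (Op (RAdd 19 0 0)) s2)) as E3 by (apply Env_den; auto).
  set (s3 := den (Op (RAdd 19 0 0)) s2) in *.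
  assert (flags s3 2 w n) as M2 by exact K2.
  assert (flags s3 3 T m) as M3 by exact K3.
  assert (nr s3 17 = o) as M4 by exact K4.
  assert (rr s3 17 = fcost m f T) as M5 by exact H1.
  assert (rr s3 19 = 0) as M6.
  { unfold s3. ev. destruct E2 as (_ & (-> & _) & _). lra. }
  clearbody s3.
  set (c2 := For 14 0 _).
  assert (rr (den c2 s3) 19 = conn n w Dt (fun j => argmin T (Dt j) o m)) as H2.
  { pose proof (for_rule (fun k t => rr t 19 = conn k w Dt (fun j => argmin T (Dt j) o m)) 14 0
      (when 2 14 (Op (IAdd 20 17 9) ;; find_min 3 1 val_dist ;; Op (RAdd 19 19 11))) s3) as H.
    assert (nr s3 0 = n) as En by apply E3. rewrite En in H.
    apply H; clear H; [exact M6|].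
    intros k t Hk Hs Ht Inv.
    assert (Env t) as Et by exact (Env_same _ _ _ Hs E3 eq_refl).
    destruct Hs as (N & _ & A & _). pose proof (A 3%nat eq_refl) as A3.
    pose proof (A 2%nat eq_refl) as A2. pose proof (N 17%nat eq_refl) as N17. clear N A.
    rewrite (when_den 2 14 _ t (w k)); [|apply Et|rewrite A2, Ht; auto].
    unfold conn. cbn [sum_upto]. fold (conn k w Dt (fun j => argmin T (Dt j) o m)).
    destruct (w k); cbn [ind]; [|ev; rewrite Inv; lra].
    assert (Env (den (Ld 12 2 14) t)) as E4 by (apply Env_den; auto).
    set (t1 := den (Ld 12 2 14) t) in *.
    assert (flags t1 3 T m) as L3 by (apply (flags_ar s3); auto).
    assert (nr t1 14 = k) as L4 by exact Ht.
    assert (nr t1 17 = o) as L5 by (change (nr t 17 = o); congruence).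
    assert (rr t1 19 = conn k w Dt (fun j => argmin T (Dt j) o m)) as L6 by exact Inv.
    clearbody t1. seqs.
    assert (Env (den (Op (IAdd 20 17 9)) t1)) as E5 by (apply Env_den; auto).
    set (t2 := den (Op (IAdd 20 17 9)) t1) in *.
    assert (flags t2 3 T m) as O3 by exact L3.
    assert (nr t2 14 = k) as O4 by exact L4.
    assert (nr t2 20 = o) as O5.
    { unfold t2. ev. destruct E4 as ((_ & _ & _ & _ & _ & _ & ->) & _). lia. }
    assert (rr t2 19 = conn k w Dt (fun j => argmin T (Dt j) o m)) as O6 by exact L6.
    clearbody t2.
    assert (nr t2 1 = m) as Em by apply E5.
    destruct (find_min_spec t2 3 1 m _ _ val_dist E5 Em ltac:(lia) O3 ltac:(lia)
      (val_dist_ok t2 E5 ltac:(lia))) as ((N1 & R1 & A1) & P1 & P2).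
    set (t3 := den (find_min 3 1 val_dist) t2) in *. clearbody t3.
    ev. now rewrite P2, R1, O4, O5, O6 by lia. }
  destruct (den_same c2 s3) as (_ & R & _).
  assert (rr (den c2 s3) 17 = fcost m f T) as H3 by (rewrite R; auto).
  set (s4 := den c2 s3) in *. clearbody s4. ev. rewrite H2, H3. reflexivity.
Qed.

(** * The local search as executed by the program *)

Definition holds (s : mem) (a : (nat -> bool) * R) : Prop :=
  flags s 3 (fst a) m /\ rr s 18 = snd a.

Lemma try_swap_spec s a : Env s -> flags s 2 w n -> holds s a ->
  (nr s 16 < m)%nat -> (nr s 17 < m)%nat ->
  holds (den try_swap s) (trial n m w f Dt Q (nr s 17) (nr s 16) a).
Proof.
  intros E F2 [F3 H18] H16 H17. set (x := nr s 16) in *. set (o := nr s 17) in *.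
  unfold try_swap. seqs.
  set (s4 := den (St 3 17 1) _).
  assert (Env s4) as E4 by (unfold s4; do 4 (apply Env_den; [reflexivity|]); exact E).
  assert (flags s4 2 w n) as G2 by exact F2.
  assert (nr s4 16 = x) as G16 by reflexivity.
  assert (nr s4 17 = o) as G17 by reflexivity.
  assert (rr s4 18 = snd a) as G18 by exact H18.
  assert (rr s4 20 = b2R (fst a x)) as G20 by now apply F3.
  assert (rr s4 21 = b2R (fst a o)) as G21 by now apply F3.
  assert (flags s4 3 (swap (fst a) x o) m) as G3.
  { intros i Hi. unfold s4. ev. fold x. fold o. unfold updR, swap.
    destruct E as (_ & (E0 & E1 & _) & _).
    destruct (Nat.eqb i o); [exact E1|]. destruct (Nat.eqb i x); [exact E0|auto]. }
  clearbody s4.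
  pose proof (evaluate_spec s4 _ E4 G2 G3 ltac:(lia)) as HV. rewrite G17 in HV.
  assert (Env (den evaluate s4)) as E5 by (apply Env_den; auto).
  destruct (den_same evaluate s4) as (N & R & A & _).
  pose proof (A 3%nat eq_refl) as A3. pose proof (N 16%nat eq_refl) as N16.
  pose proof (N 17%nat eq_refl) as N17. pose proof (R 18%nat eq_refl) as R18.
  pose proof (R 20%nat eq_refl) as R20. pose proof (R 21%nat eq_refl) as R21.
  rewrite G16 in N16. rewrite G17 in N17. rewrite G18 in R18.
  rewrite G20 in R20. rewrite G21 in R21.
  set (s5 := den evaluate s4) in *. clearbody s5. clear N R A.
  destruct E5 as (_ & (E0 & _ & _ & _ & _ & _ & _ & E7 & E8) & _).
  unfold trial. ev. rewrite HV, R18, E7, E8.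
  destruct (Rle_dec _ _) as [Hle|Hle].
  - split.
    + intros i Hi. cbn [fst]. ev. rewrite A3. auto.
    + ev. rewrite ?HV, E0. cbn [snd]. lra.
  - split.
    + intros i Hi. ev. rewrite R20, R21, N16, N17, A3. unfold updR.
      destruct (Nat.eqb_spec i x) as [->|Hx]; [reflexivity|].
      destruct (Nat.eqb_spec i o) as [->|Ho]; [reflexivity|].
      rewrite G3 by auto. unfold swap.
      apply Nat.eqb_neq in Hx, Ho. now rewrite Hx, Ho.
    + ev. exact R18.
Qed.

Lemma sweep_spec s a : Env s -> flags s 2 w n -> holds s a ->
  holds (den (For 16 1 (For 17 1 try_swap)) s) (sweep n m w f Dt Q a).
Proof.
  intros E F2 H. unfold sweep.
  set (g := fun i a => floop (fun o a => trial n m w f Dt Q o i a) m a).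
  pose proof (for_rule (fun k t => holds t (floop g k a)) 16 1 (For 17 1 try_swap) s) as HL.
  assert (nr s 1 = m) as Em by apply E. rewrite Em in HL.
  apply HL; clear HL; [exact H|].
  intros k t Hk Hs Ht Inv.
  assert (Env t) as Et by exact (Env_same _ _ _ Hs E eq_refl).
  assert (flags t 2 w n) as F2' by (apply (flags_ar s); auto; now apply Hs).
  change (holds (den (For 17 1 try_swap) t) (g k (floop g k a))).
  set (a1 := floop g k a) in *. unfold g.
  pose proof (for_rule (fun j u => holds u (floop (fun o a => trial n m w f Dt Q o k a) j a1))
    17 1 try_swap t) as HL.
  assert (nr t 1 = m) as Em' by apply Et. rewrite Em' in HL.
  apply HL; clear HL; [exact Inv|].
  intros j u Hj Hu Hju Inv'.
  assert (Env u) as Eu by exact (Env_same _ _ _ Hu Et eq_refl).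
  assert (flags u 2 w n) as F2u by (apply (flags_ar t); auto; now apply Hu).
  assert (nr u 16 = k) as H16 by (rewrite <- Ht; now apply Hu).
  pose proof (try_swap_spec u _ Eu F2u Inv' ltac:(lia) ltac:(lia)) as HT.
  rewrite H16, Hju in HT. exact HT.
Qed.

Lemma sweeps_spec s a c0 : Env s -> flags s 2 w n -> holds s a ->
  descended n m w f Dt Q c0 0 a ->
  exists a', holds (den sweeps s) a' /\ descended n m w f Dt Q c0 (INR n * Q) a'.
Proof.
  intros E F2 H HD. unfold sweeps.
  assert (forall j k, (j < n)%nat -> (k < m)%nat -> 0 <= Dt j k) as D_pos
    by (intros; apply dist_pos).
  assert (1 <= Q) as HQ by (apply (le_INR 1) in m_pos; simpl in m_pos; lra).
  pose proof (for_rule (fun k t => exists a', holds t a' /\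
    descended n m w f Dt Q c0 (INR k * Q) a') 18 0
    (For 19 5 (For 16 1 (For 17 1 try_swap))) s) as HL.
  assert (nr s 0 = n) as En by apply E. rewrite En in HL.
  apply HL; clear HL.
  { exists a. split; [exact H|]. simpl. now rewrite Rmult_0_l. }
  intros k t Hk Hs Ht (a1 & I1 & I2).
  assert (Env t) as Et by exact (Env_same _ _ _ Hs E eq_refl).
  assert (flags t 2 w n) as F2' by (apply (flags_ar s); auto; now apply Hs).
  pose proof (for_rule (fun j u => exists a', holds u a' /\
    descended n m w f Dt Q c0 (INR k * Q + INR j) a') 19 5
    (For 16 1 (For 17 1 try_swap)) t) as HL.
  assert (nr t 5 = (64 * m)%nat) as Em by apply Et. rewrite Em in HL.
  destruct HL as (a2 & J1 & J2).
  - exists a1. split; [exact I1|]. simpl. now rewrite Rplus_0_r.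
  - intros j u Hj Hu Hju (a2 & J1 & J2).
    assert (Env u) as Eu by exact (Env_same _ _ _ Hu Et eq_refl).
    assert (flags u 2 w n) as F2u by (apply (flags_ar t); auto; now apply Hu).
    exists (sweep n m w f Dt Q a2). split; [exact (sweep_spec u a2 Eu F2u J1)|].
    rewrite S_INR, <- Rplus_assoc. apply sweep_descended; auto.
    + apply I_valid.
    + pose proof (pos_INR k). pose proof (pos_INR j). nra.
  - exists a2. split; [exact J1|]. rewrite mult_INR in J2.
    replace (INR (S k) * Q) with (INR k * Q + INR 64 * INR m); [exact J2|].
    rewrite (S_INR k). replace (INR 64) with 64 by (simpl; lra). ring.
Qed.

Definition opened_list (S : nat -> bool) (k : nat) : list nat :=
  floop (fun i L => if S i then i :: L else L) k [].

(** The reversal reflects that [OutSensor] pushes onto the front of the output. *)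
Definition sensor_list (sg : nat -> nat) (k : nat) : list (nat * point) :=
  floop (fun i L => if w i then map (pair (sg i)) (rev (spots (tg I i) r)) ++ L else L) k [].

Lemma emit_spec s : Env s -> (nr s 14 < n)%nat ->
  os (den emit s) = map (pair (nr s 20)) (rev (spots (tg I (nr s 14)) r)) ++ os s.
Proof.
  intros E Hk. pose proof E as ((_ & _ & _ & E6 & _) & (_ & _ & _ & _ & E4 & E5 & ER6 & _) & EI).
  unfold emit. name_states. unwind.
  rewrite E4, E5, E6, ER6, !EI, input_tx, input_ty by auto.
  unfold spots. destruct (tg I (nr s 14)). reflexivity.
Qed.

Lemma opened_spec s S : Env s -> flags s 3 S m -> oo s = [] ->
  oo (den (For 15 1 (when 3 15 (Op (OutOpen 15)))) s) = opened_list S m.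
Proof.
  intros E F3 Hoo.
  pose proof (for_rule (fun k t => oo t = opened_list S k) 15 1
    (when 3 15 (Op (OutOpen 15))) s) as H.
  assert (nr s 1 = m) as Em by apply E. rewrite Em in H.
  apply H; clear H; [exact Hoo|].
  intros k t Hk Hs Ht Inv.
  assert (Env t) as Et by exact (Env_same _ _ _ Hs E eq_refl).
  destruct Hs as (_ & _ & A & _). pose proof (A 3%nat eq_refl) as A3.
  rewrite (when_den 3 15 _ t (S k)); [|apply Et|rewrite A3, Ht; auto].
  unfold opened_list. cbn [floop]. fold (opened_list S k).
  destruct (S k); ev; rewrite ?Inv, ?Ht; auto.
Qed.

Lemma sensor_step s S d L : Env s -> (nr s 14 < n)%nat -> flags s 3 S m ->
  nr s 21 = d -> (d < m)%nat -> os s = L ->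
  os (den (Op (IAdd 20 21 9) ;; find_min 3 1 val_dist ;; emit) s) =
  map (pair (argmin S (D I (nr s 14)) d m)) (rev (spots (tg I (nr s 14)) r)) ++ L.
Proof.
  intros E Hk F3 Hd Hdm HL. seqs.
  assert (Env (den (Op (IAdd 20 21 9)) s)) as E2 by (apply Env_den; auto).
  set (t2 := den (Op (IAdd 20 21 9)) s) in *.
  assert (flags t2 3 S m) as O3 by exact F3.
  assert (nr t2 14 = nr s 14) as O4 by reflexivity.
  assert (nr t2 20 = d) as O5.
  { unfold t2. ev. destruct E as ((_ & _ & _ & _ & _ & _ & ->) & _). lia. }
  assert (os t2 = L) as O7 by exact HL.
  clearbody t2.
  assert (nr t2 1 = m) as Em2 by apply E2.
  destruct (find_min_spec t2 3 1 m _ _ val_dist E2 Em2 ltac:(lia) O3 ltac:(lia)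
    (val_dist_ok t2 E2 ltac:(lia))) as ((N1 & R1 & A1) & P3 & _).
  destruct (den_same (find_min 3 1 val_dist) t2) as (_ & _ & _ & _ & Q7). specialize (Q7 eq_refl).
  assert (Env (den (find_min 3 1 val_dist) t2)) as E6 by (apply Env_den; auto).
  set (t3 := den (find_min 3 1 val_dist) t2) in *. clearbody t3.
  assert (nr t3 14 = nr s 14) as Q4 by (rewrite N1; auto; lia).
  rewrite O7 in Q7. rewrite O4, O5 in P3.
  rewrite (emit_spec t3 E6) by lia. now rewrite Q4, Q7, P3.
Qed.

Lemma sensors_spec s S d : Env s -> flags s 2 w n -> flags s 3 S m ->
  nr s 21 = d -> (d < m)%nat -> os s = [] ->
  os (den (For 14 0 (when 2 14 (Op (IAdd 20 21 9) ;; find_min 3 1 val_dist ;; emit))) s)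
  = sensor_list (fun j => argmin S (Dt j) d m) n.
Proof.
  intros E F2 F3 Hd Hdm Hos. set (sg := fun j => argmin S (Dt j) d m).
  set (c := Op (IAdd 20 21 9) ;; find_min 3 1 val_dist ;; emit).
  assert (forall L t, Env t -> (nr t 14 < n)%nat -> flags t 3 S m -> nr t 21 = d -> os t = L ->
    os (den c t) = map (pair (sg (nr t 14))) (rev (spots (tg I (nr t 14)) r)) ++ L) as Hc
    by (intros; now apply sensor_step).
  pose proof (for_rule (fun k t => os t = sensor_list sg k) 14 0 (when 2 14 c) s) as H.
  assert (nr s 0 = n) as En by apply E. rewrite En in H.
  apply H; clear H; [exact Hos|].
  intros k t Hk Hs Ht Inv.
  assert (Env t) as Et by exact (Env_same _ _ _ Hs E eq_refl).
  destruct Hs as (N & _ & A & _). pose proof (A 3%nat eq_refl) as A3.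
  pose proof (A 2%nat eq_refl) as A2. pose proof (N 21%nat eq_refl) as N21. clear N A.
  clearbody c.
  rewrite (when_den 2 14 _ t (w k)); [|apply Et|rewrite A2, Ht; auto].
  unfold sensor_list. cbn [floop]. fold (sensor_list sg k).
  destruct (w k); [|exact Inv].
  assert (Env (den (Ld 12 2 14) t)) as E4 by (apply Env_den; auto).
  specialize (Hc (sensor_list sg k) (den (Ld 12 2 14) t) E4).
  set (t1 := den (Ld 12 2 14) t) in *.
  assert (flags t1 3 S m) as L3 by (apply (flags_ar s); auto).
  assert (nr t1 14 = k) as L4 by exact Ht.
  assert (nr t1 21 = d) as L5 by (change (nr t 21 = d); congruence).
  assert (os t1 = sensor_list sg k) as L7 by exact Inv.
  clearbody t1. rewrite L4 in Hc. rewrite os_wrN. now apply Hc.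
Qed.

Lemma output_spec s S : Env s -> flags s 2 w n -> flags s 3 S m ->
  oo s = [] -> os s = [] ->
  exists d, (d < m)%nat /\
    ((exists k, (k < m)%nat /\ S k = true) -> (d < m)%nat /\ S d = true) /\
    oo (den output s) = opened_list S m /\
    os (den output s) = sensor_list (fun j => argmin S (Dt j) d m) n.
Proof.
  intros E F2 F3 Hoo Hos. unfold output. seqs.
  assert (nr s 1 = m) as Em by apply E.
  destruct (find_any_spec s 3 1 m S E Em ltac:(lia) F3) as (A1 & P1 & P2).
  destruct (den_same (find_any 3 1) s) as (_ & _ & _ & O1 & O2).
  specialize (O1 eq_refl). specialize (O2 eq_refl).
  set (s1 := den (find_any 3 1) s) in *. clearbody s1. set (d := nr s1 20) in *.
  exists d. split; [lia|]. split; [exact P2|].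
  assert (Env s1) as E1 by now apply (Env_agree s).
  assert (Env (den (Op (IAdd 21 20 9)) s1)) as E2 by (apply Env_den; auto).
  set (s2 := den (Op (IAdd 21 20 9)) s1) in *.
  assert (flags s2 2 w n) as G2 by (apply (flags_ar s); auto; apply A1).
  assert (flags s2 3 S m) as G3 by (apply (flags_ar s); auto; apply A1).
  assert (nr s2 21 = d) as G4.
  { unfold s2. ev. fold d. destruct E1 as ((_ & _ & _ & _ & _ & _ & ->) & _). lia. }
  rewrite Hoo in O1. rewrite Hos in O2.
  assert (oo s2 = []) as G5 by exact O1. assert (os s2 = []) as G6 by exact O2.
  clearbody s2. clear O1 O2 A1.
  pose proof (opened_spec s2 S E2 G3 G5) as H1.
  set (c1 := For 15 1 (when 3 15 (Op (OutOpen 15)))) in *.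
  assert (Env (den c1 s2)) as E3 by (apply Env_den; auto).
  destruct (den_same c1 s2) as (N & _ & A & _ & K5).
  specialize (K5 eq_refl). rewrite G6 in K5.
  pose proof (N 21%nat eq_refl) as K4. rewrite G4 in K4.
  assert (flags (den c1 s2) 2 w n) as K2 by (apply (flags_ar s2); auto).
  assert (flags (den c1 s2) 3 S m) as K3 by (apply (flags_ar s2); auto).
  set (s3 := den c1 s2) in *. clearbody s3. clear N A c1.
  split.
  - destruct (den_same (For 14 0 (when 2 14 (Op (IAdd 20 21 9) ;; find_min 3 1 val_dist ;; emit)))
      s3) as (_ & _ & _ & O & _).
    now rewrite O.
  - apply sensors_spec; auto. lia.
Qed.

End Instance.

(** * Correctness of the whole machine program *)

Lemma in_opened_list S K k : In k (opened_list S K) <-> (k < K)%nat /\ S k = true.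
Proof.
  unfold opened_list. induction K as [|K IH]; [simpl; split; [tauto|lia]|].
  simpl. destruct (S K) eqn:E; simpl; rewrite IH; split.
  - intros [->|[H1 H2]]; auto.
  - intros [H1 H2]. destruct (Nat.eq_dec K k); auto. right. split; auto. lia.
  - intros [H1 H2]; auto.
  - intros [H1 H2]. split; auto. destruct (Nat.eq_dec K k); [congruence|lia].
Qed.

Section Instance.
Variable I : instance.
Hypothesis I_valid : valid_instance I.
Hypothesis I_far : far_instance I.
Hypothesis m_pos : (0 < m_bs I)%nat.
Notation n := (n_tg I).
Notation m := (m_bs I).
Notation r := (radius I).
Notation f := (ocost I).
Notation Dt := (D I).
Notation Q := (64 * INR m).

Lemma in_sensor_list w sg K s : In s (sensor_list I w sg K) <->
  exists i, (i < K)%nat /\ w i = true /\ fst s = sg i /\ In (snd s) (spots (tg I i) r).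
Proof.
  unfold sensor_list. induction K as [|K IH]; [simpl; split; [tauto|intros (i & Hi & _); lia]|].
  cbn [floop]. split.
  - intros H.
    assert (In s (if w K then map (pair (sg K)) (rev (spots (tg I K) r)) else []) \/
      exists i, (i < K)%nat /\ w i = true /\ fst s = sg i /\ In (snd s) (spots (tg I i) r))
      as [H1|(i & Hi & H1)].
    { destruct (w K); [apply in_app_or in H as [H|H]|]; auto; right; now apply IH. }
    + destruct (w K) eqn:E; [|destruct H1]. exists K. split; [lia|]. split; auto.
      apply in_map_iff in H1 as (q & <- & Hq). split; auto. now apply in_rev.
    + exists i. split; [lia|auto].
  - intros (i & Hi & Hw & Hs & Hq). destruct (Nat.eq_dec i K) as [->|Hne].
    + rewrite Hw. apply in_or_app. left. apply in_map_iff. exists (snd s).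
      split; [rewrite <- Hs; now destruct s|now apply -> in_rev].
    + assert (exists i, (i < K)%nat /\ w i = true /\ fst s = sg i /\
        In (snd s) (spots (tg I i) r)) as H by (exists i; split; [lia|auto]).
      apply IH in H. destruct (w K); auto. apply in_or_app. now right.
Qed.

Lemma total_sensor_list w sg K :
  (K <= n)%nat -> (forall i, (i < K)%nat -> w i = true -> (sg i < m)%nat) ->
  total (bs I) (sensor_list I w sg K) <= 46 / 10 * conn K w Dt sg.
Proof.
  unfold sensor_list, conn. induction K as [|K IH]; intros HK H; [simpl; lra|].
  assert (forall i, (i < K)%nat -> w i = true -> (sg i < m)%nat) as H' by auto.
  specialize (IH ltac:(lia) H').
  cbn [floop sum_upto]. destruct (w K) eqn:E; cbn [ind]; [|lra].
  rewrite total_app.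
  pose proof (spots_total (bs I) (sg K) (tg I K) r (proj1 I_valid)
    (I_far K (sg K) ltac:(lia) (H K ltac:(lia) E))) as Hs.
  unfold D in *. lra.
Qed.

Lemma solution_good unc w c0 a d :
  net I n unc w -> c0 = init_cost m w f Dt n ->
  descended n m w f Dt Q c0 (INR n * Q) a ->
  ((exists k, (k < m)%nat /\ fst a k = true) -> (d < m)%nat /\ fst a d = true) ->
  let sol := Solution (fun k => existsb (Nat.eqb k) (opened_list (fst a) m))
               (sensor_list I w (fun j => argmin (fst a) (Dt j) d m) n) in
  feasible I sol /\
  forall S, feasible I S -> sol_cost I sol <= 8928 / 1000 * sol_cost I S.
Proof.
  intros HN Hc0 HD Hd sol. set (sg := fun j => argmin (fst a) (Dt j) d m) in *.
  assert (serves n m w (fst a) sg) as Hsg.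
  { destruct HD as ((sg0 & S0 & _) & _). intros j Hj Hw. destruct (S0 j Hj Hw) as [H1 H2].
    apply argmin_mem; auto; apply Hd; eauto. }
  assert (forall k, opened sol k = true <-> (k < m)%nat /\ fst a k = true) as HO.
  { intros k. rewrite <- in_opened_list. cbn [sol opened]. rewrite existsb_exists. split.
    - intros (y & Hy & E). now apply Nat.eqb_eq in E as ->.
    - intros H. exists k. now rewrite Nat.eqb_refl. }
  split; [split; [|split]|].
  - intros k Hk. now apply HO.
  - intros s Hs. apply in_sensor_list in Hs as (i & Hi & Hw & -> & _).
    destruct (Hsg i Hi Hw). split; auto. now apply HO.
  - intros i Hi. destruct (net_covers I I_valid unc w i HN Hi) as (p & Hp & Hw & q & Hq & Hdq).
    exists (sg p, q). split; auto. apply in_sensor_list. exists p. auto.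
  - intros S (F1 & F2 & F3). unfold sol_cost at 1.
    assert (sum_upto (fun k => if opened sol k then f k else 0) m = fcost m f (fst a)) as ->.
    { apply sum_ext. intros k Hk. destruct (opened sol k) eqn:E1, (fst a k) eqn:E2; auto.
      - apply HO in E1. destruct E1. congruence.
      - rewrite (proj2 (HO k)) in E1 by auto. discriminate. }
    fold (total (bs I) (sensors sol)). cbn [sol sensors].
    pose proof (total_sensor_list w sg n (Nat.le_refl n) (fun i Hi Hw => proj1 (Hsg i Hi Hw))) as HT.
    destruct HN as (_ & _ & N3 & _).
    destruct (separated_lower_bound I I_far (sensors S) w) as (op & O1 & O2); auto.
    { intros s Hs. now apply F2. }
    assert (serves n m w (opened S) op) as Hop.
    { intros i Hi Hw. destruct (O1 i Hi Hw) as (s & Hs & ->). now apply F2. }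
    subst c0.
    pose proof (descent_bound n m w f Dt (fun o s => dist (bs I o) (bs I s)) m_pos
      (proj2 I_valid) (fun j k _ _ => dist_pos _ _)) as HB.
    assert (fcost m f (fst a) + 46 / 10 * conn n w Dt sg <=
      6 * fcost m f (opened S) + 7 * conn n w Dt op) as HB'.
    { apply HB; auto; intros j o s _ _ _; unfold D.
      - rewrite (dist_sym (tg I j) (bs I o)). apply dist_triangle.
      - apply dist_triangle.
      - rewrite (dist_sym (bs I o)). apply dist_triangle. }
    unfold sol_cost. fold (total (bs I) (sensors S)). fold (fcost m f (opened S)).
    (* The bound is now 6 times the opening cost plus 70/9 times the sensor total of [S]; as both
       costs are nonnegative, 8.928 dominates both coefficients. *)
    pose proof (total_nonneg (bs I) (sensors S)).
    pose proof (fcost_nonneg m f (proj2 I_valid) (opened S)).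
    lra.
Qed.

Lemma main_spec s : nr s 0 = n -> nr s 1 = m -> nr s 5 = (64 * m)%nat ->
  (forall x j, ar s x j = if Nat.eqb x 0 then input_rm I j else 0) ->
  oo s = [] -> os s = [] ->
  let sol := Solution (fun k => existsb (Nat.eqb k) (oo (den main s))) (os (den main s)) in
  feasible I sol /\
  forall S, feasible I S -> sol_cost I sol <= 8928 / 1000 * sol_cost I S.
Proof.
  intros H0 H1 H5 HA Hoo Hos. unfold main. seqs.
  pose proof (setup_spec I s H0 H1 H5 (HA 0%nat)) as E1.
  destruct (den_same setup s) as (_ & _ & A1 & O1 & P1).
  pose proof (A1 2%nat eq_refl) as A12. pose proof (A1 3%nat eq_refl) as A13.
  specialize (O1 eq_refl). specialize (P1 eq_refl). rewrite Hoo in O1. rewrite Hos in P1.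
  set (s1 := den setup s) in *. clearbody s1.
  destruct (build_net_spec I I_valid s1 E1) as (unc & w & F2 & HN).
  { intros j. rewrite A12, HA. reflexivity. }
  destruct (den_same build_net s1) as (_ & _ & A2 & O2 & P2).
  pose proof (A2 3%nat eq_refl) as A23.
  specialize (O2 eq_refl). specialize (P2 eq_refl). rewrite O1 in O2. rewrite P1 in P2.
  assert (Env I (den build_net s1)) as E2 by (apply Env_den; auto).
  set (s2 := den build_net s1) in *. clearbody s2.
  destruct (initial_spec I w m_pos s2 E2 F2) as [G3 G18].
  { intros j. rewrite A23, A13, HA. reflexivity. }
  destruct (den_same initial s2) as (_ & _ & A3 & O3 & P3).
  pose proof (A3 2%nat eq_refl) as A32.
  specialize (O3 eq_refl). specialize (P3 eq_refl). rewrite O2 in O3. rewrite P2 in P3.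
  assert (Env I (den initial s2)) as E3 by (apply Env_den; auto).
  set (s3 := den initial s2) in *. clearbody s3.
  assert (flags s3 2 w n) as F32 by now apply (flags_ar s2).
  assert (0 <= Q) as HQ by (pose proof (pos_INR m); lra).
  destruct (sweeps_spec I I_valid w m_pos s3
    (init_set m w f Dt n, init_cost m w f Dt n) (init_cost m w f Dt n) E3 F32 (conj G3 G18)
    (init_descended n m w f Dt m_pos (proj2 I_valid) Q HQ)) as (a & [G4 _] & HD).
  destruct (den_same sweeps s3) as (_ & _ & A4 & O4 & P4).
  pose proof (A4 2%nat eq_refl) as A42.
  specialize (O4 eq_refl). specialize (P4 eq_refl). rewrite O3 in O4. rewrite P3 in P4.
  assert (Env I (den sweeps s3)) as E4 by (apply Env_den; auto).
  set (s4 := den sweeps s3) in *. clearbody s4.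
  assert (flags s4 2 w n) as F42 by now apply (flags_ar s3).
  destruct (output_spec I w m_pos s4 (fst a) E4 F42 G4 O4 P4) as (d & _ & Hd & -> & ->).
  exact (solution_good unc w _ a d HN eq_refl HD Hd).
Qed.
End Instance.

(** * Moving the input out of low memory, and the total running time *)

Definition save (j : nat) : list instr := [IConst 2 (4 * j); IAdd 2 2 3; RStore 2 j].

Definition base_code : list instr :=
  [IConst 4 1; IAdd 3 0 0; IAdd 3 3 1; IAdd 3 3 1; IAdd 3 3 1; IConst 2 (NR + 1); IAdd 3 3 2].

Definition copy_body : list instr :=
  [RLoad 0 5; IConst 2 0; IAdd 2 5 5; IAdd 2 2 2; IAdd 2 2 3; RStore 2 0; IAdd 5 5 4].

Definition copy_loop (q : nat) : list instr :=
  [JIle 3 5 (q + 9)] ++ copy_body ++ [JIle 5 5 q].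

Definition head_code : list instr :=
  base_code ++ flat_map save (seq 0 NR) ++ [IConst 5 NR].

(** Five doublings of 2m leave 64m in register 5, which until then served as the copy counter. *)
Definition tail_code : list instr :=
  [IAdd 5 1 1; IAdd 5 5 5; IAdd 5 5 5; IAdd 5 5 5; IAdd 5 5 5; IAdd 5 5 5].

(* The inputs occupy low memory, where the program needs its scalar registers:
   the first NR cells are saved one by one, the others by a loop. *)
Definition prologue : list instr :=
  head_code ++ copy_loop (length head_code) ++ tail_code.

Section Prologue.
Variable I : instance.
Notation n := (n_tg I).
Notation m := (m_bs I).
(** This lies beyond the last input cell 2n + 3m, which holds the radius, so copies never overwrite
    input still to be read, and beyond the [NR] scalar cells. *)
Definition base : nat := 2 * n + 3 * m + (NR + 1).

Lemma input_rm_high j : (2 * n + 3 * m < j)%nat -> input_rm I j = 0.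
Proof.
  intros Hj. unfold input_rm.
  rewrite !(proj2 (Nat.ltb_ge _ _)) by lia. rewrite (proj2 (Nat.eqb_neq _ _)) by lia. reflexivity.
Qed.

(** Cells from [lo] up to [base] still hold the input, and [k] entries have been copied. [lo] rises
    from 0 to [NR] once the low cells are saved, since the copy loop passes values through cell
    0. *)
Definition copied (lo k : nat) (c : config) : Prop :=
  (im c 0 = n /\ im c 1 = m /\ im c 3 = base /\ im c 4 = 1%nat) /\
  (out_open c = [] /\ out_sens c = []) /\
  (forall a, (lo <= a < base)%nat -> rm c a = input_rm I a) /\
  (forall j x, (x < 4)%nat -> rm c (base + 4 * j + x) =
     if Nat.eqb x 0 && Nat.ltb j k then input_rm I j else 0).

Lemma copied_store lo k c d i v p' :
  (lo <= base)%nat -> copied lo k c -> (forall a, a <> 2%nat -> a <> 5%nat -> i a = im c a) ->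
  d = (base + 4 * k)%nat -> v = input_rm I k ->
  copied lo (S k) (Config p' (updR (rm c) d v) i (out_open c) (out_sens c)).
Proof.
  intros Hlo ((H0 & H1 & H3 & H4) & HO & HL & HA) Hi -> ->.
  split; [|split; [exact HO|split]]; cbn [im rm out_open out_sens].
  - rewrite !Hi by lia. auto.
  - intros a Ha. rewrite updR_neq by lia. auto.
  - intros j x Hx. destruct (Nat.eqb_spec x 0) as [->|Hx0]; cbn [andb].
    + destruct (Nat.eq_dec j k) as [->|Hjk].
      * rewrite Nat.add_0_r, updR_eq. now rewrite (proj2 (Nat.ltb_lt _ _)) by lia.
      * rewrite updR_neq by lia. rewrite HA by lia. cbn [Nat.eqb andb].
        destruct (Nat.ltb_spec j k), (Nat.ltb_spec j (S k)); auto; lia.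
    + rewrite updR_neq by lia. rewrite HA by lia. now rewrite (proj2 (Nat.eqb_neq _ _) Hx0).
Qed.

Lemma copied_init : copied 0 0 (fold_left ex base_code (init_config I)).
Proof.
  split; [|split; [split; reflexivity|split]].
  - repeat split; try reflexivity. cbv - [base Nat.mul Nat.add NR n_tg m_bs]. unfold base. lia.
  - reflexivity.
  - intros j x Hx. cbn [Nat.ltb]. rewrite andb_false_r.
    change (input_rm I (base + 4 * j + x) = 0). apply input_rm_high. unfold base. lia.
Qed.

Lemma copied_saves k : (k <= NR)%nat ->
  copied 0 k (fold_left ex (flat_map save (seq 0 k)) (fold_left ex base_code (init_config I))).
Proof.
  induction k as [|k IH]; intros Hk; [exact copied_init|].
  specialize (IH ltac:(lia)).
  rewrite seq_S, flat_map_app, fold_left_app. set (c := fold_left ex _ _) in *. clearbody c.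
  cbn [Nat.add flat_map app save fold_left ex setN setR pc rm im out_open out_sens].
  apply (copied_store 0 k c); [lia|exact IH| | |].
  - intros a Ha _. cbn [setN im]. now rewrite !updN_neq.
  - destruct IH as ((_ & _ & H3 & _) & _). cbn [setN im]. rewrite updN_eq, updN_eq, updN_neq by lia. lia.
  - destruct IH as (_ & _ & HL & _). apply HL. unfold base. lia.
Qed.

Lemma copied_counter k c : copied 0 k c ->
  copied NR k (ex c (IConst 5 NR)) /\ im (ex c (IConst 5 NR)) 5 = NR.
Proof.
  intros ((H0 & H1 & H3 & H4) & HO & HL & HA). split; [|apply updN_eq].
  split; [|split; [exact HO|split; cbn [ex setN rm im]]].
  - cbn [ex setN im]. rewrite !updN_neq by lia. auto.
  - intros a Ha. apply HL. lia.
  - exact HA.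
Qed.

Lemma copied_head : copied NR NR (fold_left ex head_code (init_config I)) /\
  im (fold_left ex head_code (init_config I)) 5 = NR.
Proof.
  unfold head_code. rewrite !fold_left_app.
  exact (copied_counter NR _ (copied_saves NR (Nat.le_refl NR))).
Qed.

Lemma copy_loop_correct p q k : code_at p q (copy_loop q) -> forall c j,
  pc c = q -> (NR <= j)%nat -> (j + k = base)%nat -> im c 5 = j -> copied NR j c ->
  exists c', nsteps p (9 * k + 1) c = Some c' /\ pc c' = (q + 9)%nat /\ copied NR base c'.
Proof.
  intros Hp. unfold copy_loop in Hp.
  apply code_at_app in Hp as [HJ Hp]. apply code_at_app in Hp as [HB HJ'].
  apply code_at_cons in HJ as [HJ _]. apply code_at_cons in HJ' as [HJ' _].
  induction k as [|k IH]; intros c j Hpc Hj Hjk H5 HC.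
  - rewrite <- Hpc in HJ at 1. pose proof (one_step p c _ HJ ltac:(discriminate)) as E.
    pose proof HC as ((_ & _ & H3 & _) & _).
    cbn [ex] in E. rewrite H3, H5 in E. unfold jump in E.
    rewrite (proj2 (Nat.leb_le _ _)) in E by lia.
    eexists. split; [exact E|]. split; [reflexivity|].
    replace j with base in HC by lia. exact HC.
  - assert (nth_error p (pc c) = Some (JIle 3 5 (q + 9))) as HJc by now rewrite Hpc.
    pose proof (one_step p c _ HJc ltac:(discriminate)) as E.
    pose proof HC as ((H0 & H1 & H3 & H4) & HO & HL & HA).
    cbn [ex] in E. rewrite H3, H5 in E. unfold jump in E.
    rewrite (proj2 (Nat.leb_gt _ _)) in E by lia.
    set (c1 := Config (S (pc c)) _ _ _ _) in E.
    destruct (straight_steps p copy_body (q + length [JIle 3 5 (q + 9)])%nat c1 HB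
      ltac:(simpl; lia) eq_refl) as [E1 E2].
    set (c2 := fold_left ex copy_body c1) in *.
    assert (nth_error p (pc c2) = Some (JIle 5 5 q)) as HJ2 by now rewrite E2.
    pose proof (one_step p c2 _ HJ2 ltac:(discriminate)) as E3.
    cbn [ex] in E3. unfold jump in E3. rewrite Nat.leb_refl in E3.
    set (c3 := Config q _ _ _ _) in E3.
    assert (im c3 5 = S j) as H5'.
    { unfold c3, c2, c1.
      cbn [copy_body fold_left ex setN setR im updN Nat.eqb]. lia. }
    assert (copied NR (S j) c3) as HC'.
    (* A round makes two real writes, first to cell 0. Treating that one as a separate state reduces
       the round to the single write handled by [copied_store]. *)
    { pose (c1' := Config (pc c1) (updR (rm c) 0 (rm c j)) (im c) (out_open c) (out_sens c)).
      assert (copied NR j c1') as HCC.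
      { split; [split; auto|split; [exact HO|split; cbn [c1' rm]]].
        - intros a Ha. rewrite updR_neq by (unfold NR in *; lia). auto.
        - intros i x Hx. rewrite updR_neq by (unfold base, NR in *; lia). auto. }
      assert (c3 = Config q (updR (rm c1') (base + 4 * j) (input_rm I j)) (im c3)
        (out_open c1') (out_sens c1')) as ->.
      { unfold c3, c2, c1, c1'.
        cbn [copy_body fold_left ex setN setR im rm out_open out_sens updN Nat.eqb].
        rewrite H3, H5, updR_eq, <- (HL j) by lia. do 2 f_equal. lia. }
      apply copied_store; auto; [unfold base; lia|].
      intros a Ha2 Ha5. unfold c3, c2, c1, c1'.
      cbn [copy_body fold_left ex setN setR im]. now rewrite !updN_neq. }
    destruct (IH c3 (S j) eq_refl ltac:(lia) ltac:(lia) H5' HC') as (c' & E4 & E5 & E6).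
    exists c'. split; [|auto].
    replace (9 * S k + 1)%nat with (1 + (7 + (1 + (9 * k + 1))))%nat by lia.
    apply (nsteps_add p _ _ _ _ _ E), (nsteps_add p _ _ _ _ _ E1), (nsteps_add p _ _ _ _ _ E3 E4).
Qed.

Lemma prologue_correct p : code_at p 0 prologue ->
  exists t c s, (t <= 200 * (n + m + 1))%nat /\ nsteps p t (init_config I) = Some c /\
    pc c = length prologue /\ sim base s c /\
    nr s 0 = n /\ nr s 1 = m /\ nr s 5 = (64 * m)%nat /\
    (forall x j, ar s x j = if Nat.eqb x 0 then input_rm I j else 0) /\
    oo s = [] /\ os s = [].
Proof.
  intros Hp. unfold prologue in Hp.
  apply code_at_app in Hp as [H1 Hp]. apply code_at_app in Hp as [H2 H3].
  destruct (straight_steps p head_code 0 (init_config I) H1 eq_refl eq_refl) as [E1 P1].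
  destruct copied_head as [C1 I1].
  set (c1 := fold_left ex head_code (init_config I)) in *.
  set (q := length head_code) in *. rewrite Nat.add_0_l in *.
  destruct (copy_loop_correct p q (base - NR) H2 c1 NR P1 (Nat.le_refl NR)
    ltac:(unfold base; lia) I1 C1) as (c2 & E2 & P2 & C2).
  assert (length (copy_loop q) = 9%nat) as Hlen by reflexivity. rewrite Hlen in H3.
  destruct (straight_steps p tail_code (q + 9) c2 H3 P2 eq_refl) as [E3 P3].
  set (c3 := fold_left ex tail_code c2) in *.
  destruct C2 as ((I0 & I1' & I3 & I4) & (O1 & O2) & HL & HA).
  exists (q + (9 * (base - NR) + 1 + 6))%nat, c3,
    (Mem (im c3) (rm c3) (fun x j => if Nat.eqb x 0 then input_rm I j else 0) [] []).
  assert (q = 104%nat) as Hq by reflexivity.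
  split; [rewrite Hq; unfold base; lia|].
  split; [apply (nsteps_add p _ _ _ _ _ E1), (nsteps_add p _ _ _ _ _ E2 E3)|].
  split.
  { rewrite P3. unfold prologue.
    rewrite (length_app head_code), (length_app (copy_loop _)). fold q. rewrite Hlen. lia. }
  assert (forall a, a <> 5%nat -> im c3 a = im c2 a) as Him.
  { intros a Ha. unfold c3. cbn [tail_code fold_left ex setN im]. now rewrite !updN_neq. }
  cbn [nr rr ar oo os].
  split; [|rewrite !Him by lia; repeat split; auto].
  - split; [unfold base; lia|]. rewrite !Him by lia.
    repeat split; auto. intros x j Hx.
    change (rm c3) with (rm c2). cbn [ar]. rewrite HA by auto.
    destruct (Nat.eqb_spec x 0); cbn [andb]; auto.
    (* Entries from index [base] on are not copied, but there memory and [input_rm] are both 0. *)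
    destruct (Nat.ltb_spec j base); auto. symmetry. apply input_rm_high. unfold base in *. lia.
  - unfold c3. cbn [tail_code fold_left ex setN im updN Nat.eqb]. lia.
Qed.
End Prologue.

Definition program : list instr := prologue ++ comp (length prologue) main.

(** All loop bounds are at most 64N with N = n + m + 1, and doubling this in [tb_poly] gives the
    base 128. The prologue takes at most 200N steps, absorbed because the nesting depth is at least
    1. *)
Lemma program_correct I : valid_instance I -> (0 < m_bs I)%nat -> far_instance I ->
  exists c', run program ((200 + csz main * 128 ^ depth main) * (n_tg I + m_bs I + 1) ^ depth main)
      (init_config I) = Some c' /\
    feasible I (output_solution c') /\
    forall S, feasible I S -> sol_cost I (output_solution c') <= 8928 / 1000 * sol_cost I S.
Proof.
  intros Hv Hm Hf. set (N := (n_tg I + m_bs I + 1)%nat).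
  assert (code_at program 0 (prologue ++ comp (length prologue) main)) as Hc by easy.
  apply code_at_app in Hc as [Hc1 Hc2]. rewrite Nat.add_0_l in Hc2.
  destruct (prologue_correct I program Hc1)
    as (t1 & c1 & s & T1 & E1 & P1 & S1 & H0 & H1 & H5 & HA & Hoo & Hos).
  destruct (comp_correct main (base I) (64 * N) program (length prologue) s c1 main_wf Hc2 P1 S1)
    as (t2 & c2 & T2 & E2 & P2 & S2).
  { intros x Hx. unfold param in Hx. rewrite !orb_true_iff, !Nat.eqb_eq in Hx.
    destruct Hx as [[->| ->]| ->]; rewrite ?H0, ?H1, ?H5; unfold N; lia. }
  pose proof (tb_poly main (64 * N) ltac:(lia)) as T3.
  exists c2. split.
  - apply (run_nsteps program (t1 + t2)).
    + now apply (nsteps_add _ _ _ _ c1).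
    (* The program has no [Halt]: it stops by running past its last instruction. *)
    + unfold step. replace (nth_error program (pc c2)) with (@None instr); [reflexivity|].
      symmetry. apply nth_error_None. rewrite P2. unfold program.
      rewrite length_app, length_comp. lia.
    + replace (2 * (64 * N))%nat with (128 * N)%nat in T3 by lia.
      rewrite Nat.pow_mul_l in T3.
      assert (N <= N ^ depth main)%nat as T4.
      { rewrite <- (Nat.pow_1_r N) at 1. apply Nat.pow_le_mono_r; [lia|].
        apply Nat.leb_le. reflexivity. }
      fold N in T1. clearbody N.
      set (K := (N ^ depth main)%nat) in *. set (M := (128 ^ depth main)%nat) in *.
      set (Z := csz main) in *. clearbody K M Z.
      rewrite Nat.mul_add_distr_r, <- Nat.mul_assoc. lia.
  - destruct S2 as (_ & _ & _ & _ & _ & _ & O1 & O2).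
    pose proof (main_spec I Hv Hf Hm s H0 H1 H5 HA Hoo Hos) as H.
    unfold output_solution. rewrite O1, O2. exact H.
Qed.

Theorem theorem2 :
  poly_time_approx (8928 / 1000)
    (fun I => valid_instance I /\ (0 < m_bs I)%nat /\ far_instance I).
Proof.
  exists program, (200 + csz main * 128 ^ depth main)%nat, (depth main).
  intros I (Hv & Hm & Hf). now apply program_correct.
Qed.
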